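(* Let $(X,\mu)$ be a differentiability space, let $F:X\to Z$ be a Lipschitz map into a metric space $Z$, and let $\varrho(x_1,x_2)=d_Z(F(x_1),F(x_2))$. Then there is a canonical measurable subbundle $\mathcal W_\varrho\subset T^*X$ (the maximum element of the partially ordered set $\mathrm{Sub}(\varrho)$ described in the context, unique up to $\mu$-null sets) such that for every $\varrho$-Lipschitz function $v:X\to\mathbb R$ one has $dv(x)\in\mathcal W_\varrho(x)$ for $\mu$-a.e. $x\in X$. Moreover, for any countable dense subset $D_X\subset X$, the differentials of the corresponding $\varrho$-distance functions $\varrho_y=\varrho(\cdot,y)$, $y\in D_X$, span $\mathcal W_\varrho$, i.e. $\mathcal W_\varrho(x)=\operatorname{span}\{d\varrho_y(x):y\in D_X\}$ for $\mu$-a.e. $x\in X$.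
   Context: Differentiability spaces. $X$ is a complete separable metric space with metric $d_X$, and $\mu$ is a Radon measure on $X$. For a Lipschitz $f:X\to\mathbb R$, $\operatorname{Lip}f(x)=\limsup_{r\searrow0}\sup\{|f(y)-f(x)|/r:d_X(x,y)\le r\}$. Finitely many Lipschitz functions are dependent at $x$ if some nontrivial linear combination $v$ of them satisfies $\operatorname{Lip}v(x)=0$; otherwise they are independent at $x$. An $n$-dimensional chart ($n\ge1$) is a pair $(U,\phi)$ with $U\subset X$ Borel, $\mu(U)>0$, $\phi=(\phi^1,\dots,\phi^n):X\to\mathbb R^n$ Lipschitz, such that $\phi^1,\dots,\phi^n$ are independent at $\mu$-a.e. $x\in U$, and for every Lipschitz $f:X\to\mathbb R$ the tuple $(\phi^1,\dots,\phi^n,f)$ is dependent at $\mu$-a.e. $x\in U$; thus there are $\mu$-a.e. unique Borel functions $\partial f/\partial\phi^i$ on $U$ with $f(x)=f(x_0)+\sum_i\frac{\partial f}{\partial\phi^i}(x_0)(\phi^i(x)-\phi^i(x_0))+o(d_X(x,x_0))$ for $\mu$-a.e. $x_0\in U$. $(X,\mu)$ is a differentiability space if there is a countable collection (atlas) of charts $\{(U_\alpha,\phi_\alpha)\}$ with $\mu(X\setminus\bigcup_\alpha U_\alpha)=0$; an atlas is fixed such that at each point of $U_\alpha\cap U_\beta$ the components of $\phi_\alpha$ are differentiable with respect to $\phi_\beta$. The cotangent bundle $T^*X$ is the measurable vector bundle whose fibre over $x\in U_\alpha$ has basis $d\phi_\alpha^i(x)$ (transition maps given by the partial derivatives of the charts),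 and $df(x)=\sum_i\frac{\partial f}{\partial\phi_\alpha^i}(x)\,d\phi_\alpha^i(x)$. A function $v:X\to\mathbb R$ is $\varrho$-Lipschitz if $|v(x_1)-v(x_2)|\le C\varrho(x_1,x_2)$ for some $C$ and all $x_1,x_2$. A measurable subbundle of $T^*X$ is a measurable choice of a linear subspace in each fibre; subbundles are identified if they agree $\mu$-a.e. For a countable set $\Phi$ of $\varrho$-Lipschitz functions let $\mathcal W_\Phi$ be the subbundle with fibre $\operatorname{span}\{df(x):f\in\Phi\}$ at a.e. $x$. $\mathrm{Sub}(\varrho)$ is the collection of all such $\mathcal W_\Phi$, partially ordered by $\mathcal W_\Phi\preceq\mathcal W_{\Phi'}$ iff $\mathcal W_\Phi(x)\subseteq\mathcal W_{\Phi'}(x)$ for $\mu$-a.e. $x$. *)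

(* Defs.v *)
From HB Require Import structures.
From mathcomp Require Import all_boot all_order all_algebra.
From mathcomp Require Import all_classical all_reals all_analysis.

Set Implicit Arguments.
Unset Strict Implicit.
Unset Printing Implicit Defensive.

Import Order.TTheory GRing.Theory Num.Theory.
Import numFieldNormedType.Exports.

Local Open Scope classical_set_scope.
Local Open Scope ring_scope.

#[short(type="completeMetricType")]
HB.structure Definition CompleteMetric (R : numDomainType) :=
  {T of Complete T & Metric R T}.

Definition separable_space (T : topologicalType) : Prop :=
  exists2 D : set T, countable D & dense D.

Notation borel T := (g_sigma_algebraType (@open T)).

(* Locally finite and inner regular with respect to compact sets. *)
Definition radon (R : realType) (X : completeMetricType R)
    (mu : {measure set (borel X) -> \bar R}) : Prop :=
  (forall x : X, exists U : set X,
     [/\ open U, U x & (mu U < +oo)%E]) /\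
  (forall B : set (borel X), measurable B ->
     mu B = ereal_sup [set mu K | K in [set K : set X | compact K /\ K `<=` B]]).

Section Lipschitz.
Context {R : realType}.

Definition rho_lipschitz (X : Type) (V : normedModType R)
    (rho : X -> X -> R) (v : X -> V) : Prop :=
  exists C : R, forall x1 x2, `|v x1 - v x2| <= C * rho x1 x2.

Definition mlipschitz (X : metricType R) (V : normedModType R) (f : X -> V) :=
  rho_lipschitz (@mdist R X) f.

Definition lipschitz_map (X Z : metricType R) (F : X -> Z) : Prop :=
  exists C : R, forall x1 x2, mdist (F x1) (F x2) <= C * mdist x1 x2.

Definition pullback_dist (X : Type) (Z : metricType R) (F : X -> Z) :
  X -> X -> R := fun x1 x2 => mdist (F x1) (F x2).

End Lipschitz.

Section PointwiseDifferentiation.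
Context {R : realType} {X : metricType R}.

Definition Lip (f : X -> R) (x : X) : \bar R :=
  limf_esup (fun r : R =>
    ereal_sup [set (`|f y - f x| / r)%:E | y in [set y | mdist x y <= r]])
    (0 : R)^'+.

(* The components of g are linearly dependent at x, to first order. *)
Definition dependent_at n (g : X -> 'rV[R]_n) (x : X) : Prop :=
  exists2 c : 'rV[R]_n, c != 0 &
    Lip (fun y => \sum_i c ord0 i * g y ord0 i) x = 0%E.

Definition adjoin n (phi : X -> 'rV[R]_n) (f : X -> R) : X -> 'rV[R]_(n + 1) :=
  fun y => row_mx (phi y) (const_mx (f y)).

Definition is_partials n (phi : X -> 'rV[R]_n) (f : X -> R) (x0 : X)
    (c : 'rV[R]_n) : Prop :=
  (fun x => f x - f x0 - \sum_i c ord0 i * (phi x ord0 i - phi x0 ord0 i) : R^o)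
    =o_x0 (fun x => mdist x x0 : R^o).

(* The row of the partial derivatives of f with respect to phi at x0.  When phi
   is a chart and f is Lipschitz, there is exactly one c as in is_partials at
   almost every x0 of the domain; elsewhere the value is irrelevant. *)
Definition partials n (phi : X -> 'rV[R]_n) (f : X -> R) (x0 : X) : 'rV[R]_n :=
  xget 0 [set c | is_partials phi f x0 c].

End PointwiseDifferentiation.

Section DifferentiabilitySpaces.
Context {R : realType} {X : completeMetricType R}.
Variable mu : {measure set (borel X) -> \bar R}.

Record is_chart n (U : set X) (phi : X -> 'rV[R]_n) : Prop := {
  chart_dim_gt0 : (0 < n)%N ;
  chart_measurable : measurable (U : set (borel X)) ;
  chart_measure_gt0 : (0 < mu U)%E ;
  chart_lipschitz : mlipschitz phi ;
  chart_independent : \forall x \ae mu, U x -> ~ dependent_at phi x ;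
  chart_dependent : forall f : X -> R, mlipschitz f ->
    \forall x \ae mu, U x -> dependent_at (adjoin phi f) x
}.

Record chart_family := ChartFamily {
  chart_idx : countType ;
  chart_dim : chart_idx -> nat ;
  chart_dom : chart_idx -> set X ;
  chart_map : forall a : chart_idx, X -> 'rV[R]_(chart_dim a)
}.

Definition is_atlas (A : chart_family) : Prop :=
  (forall a : chart_idx A, is_chart (chart_dom a) (@chart_map A a)) /\
  mu (~` \bigcup_a chart_dom (c := A) a) = 0%E.

Definition differentiability_space : Prop := exists A, is_atlas A.

(* Everywhere, not only almost everywhere, on the overlaps. *)
Definition compatible (A : chart_family) : Prop :=
  forall (a b : chart_idx A) (x : X), chart_dom a x -> chart_dom b x ->
  forall i : 'I_(chart_dim a), exists c,
    is_partials (@chart_map A b) (fun y => chart_map a y ord0 i) x c.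

Variable A : chart_family.

(* A covector at x in chart_dom a is the row of its coordinates in the basis
   d(chart_map a)^i; its row in the chart b is obtained by multiplying on the right
   by transition a b x. *)
Definition transition (a b : chart_idx A) (x : X) : 'M[R]_(chart_dim a, chart_dim b) :=
  \matrix_i partials (@chart_map A b) (fun y => chart_map a y ord0 i) x.

Definition differential (f : X -> R) (a : chart_idx A) (x : X) : 'rV[R]_(chart_dim a) :=
  partials (@chart_map A a) f x.

(* A subspace of the cotangent fibre at x is given by its coordinate expression
   in each chart at x.  Since transition is determined by the charts only up to
   null sets, the glueing condition is imposed almost everywhere. *)
Record subbundle := Subbundle {
  fibre : forall a : chart_idx A, X -> {vspace 'rV[R]_(chart_dim a)} ;
  fibre_measurable : forall a : chart_idx A,
    exists s : 'I_(chart_dim a) -> X -> 'rV[R]_(chart_dim a),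
      (forall i j, measurable_fun (chart_dom a : set (borel X))
         (fun x : borel X => s i x ord0 j)) /\
      (forall x, chart_dom a x -> fibre a x = (\sum_i <[s i x]>)%VS) ;
  fibre_glue : \forall x \ae mu, forall a b : chart_idx A, chart_dom a x -> chart_dom b x ->
    fibre b x = (linfun (mulmxr (transition a b x)) @: fibre a x)%VS
}.

Definition subbundle_le (W W' : subbundle) : Prop :=
  \forall x \ae mu, forall a : chart_idx A, chart_dom a x ->
    (fibre W a x <= fibre W' a x)%VS.

Definition subbundle_eq (W W' : subbundle) : Prop :=
  \forall x \ae mu, forall a : chart_idx A, chart_dom a x -> fibre W a x = fibre W' a x.

Definition lin_span (V : vectType R) (S : set V) : set V :=
  [set v | exists2 l : seq V, [set` l] `<=` S & v \in span l].

Definition in_subbundle (W : subbundle) (f : X -> R) : Prop :=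
  \forall x \ae mu, forall a : chart_idx A, chart_dom a x ->
    differential f a x \in fibre W a x.

Definition spanned_by (W : subbundle) (Phi : set (X -> R)) : Prop :=
  \forall x \ae mu, forall a : chart_idx A, chart_dom a x ->
    [set` fibre W a x] = lin_span [set differential f a x | f in Phi].

Definition SubBundles (rho : X -> X -> R) : set subbundle :=
  [set W | exists Phi : set (X -> R),
     [/\ countable Phi, (forall f, Phi f -> rho_lipschitz rho f) &
         spanned_by W Phi]].

Definition is_maximum (rho : X -> X -> R) (W : subbundle) : Prop :=
  SubBundles rho W /\ (forall W', SubBundles rho W' -> subbundle_le W' W).

End DifferentiabilitySpaces.

(* Main.v *)
(* A rho-Lipschitz v is the limit of its McShane regularizations
   g_j = min_i (v(y_i) + L rho(., y_i)), y_i in D, whose differentials lie in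
   the span of the d(rho_y); the minimum is replaced by a smooth one, which is
   differentiable at ties.  It remains to see that the differential is closable.
   By the parallelogram identity, convex combinations of the g_j can be chosen
   with differentials converging in L^2, hence uniformly on a compact set K of
   positive measure.  If dv were outside the span on K, the functions
   h_j = v - g_j would tend to 0 uniformly, while dh_j tends to some alpha that
   vanishes nowhere on K.  For a sparse enough subsequence the alternating sum
   of the h_j is Lipschitz at the points of a smaller set of positive measure,
   and its slope there oscillates, from scale to scale, between two values
   differing by alpha.  The inf-convolution with a multiple of the distance turns
   it into a Lipschitz function with the same behaviour on that set, which is
   therefore nowhere differentiable on it: a contradiction. *)
Require Import Defs.
From mathcomp Require Import all_boot all_order all_algebra.
From mathcomp Require Import all_classical all_reals all_analysis.
From mathcomp Require Import measurable_realfun.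
From mathcomp Require Import ring lra.

Set Implicit Arguments.
Unset Strict Implicit.
Unset Printing Implicit Defensive.

Import Order.TTheory GRing.Theory Num.Theory.
Import numFieldNormedType.Exports.

Local Open Scope classical_set_scope.
Local Open Scope ring_scope.

(** Independence of the chart functions makes a nonzero covector visible from points arbitrarily
    close to x, but not at prescribed scales. This obstacle shapes the alternating sum: its slope is
    known only in a sequence of annuli around x, so each annulus has to reach far enough inwards to
    contain witnesses for the first few covectors of an enumeration. That is possible uniformly only
    for countably many covectors and off sets of small measure.

    Hence the rational covectors. They also settle measurability: since Lipschitz functions are
    continuous, the points from which some increment is steep form an open set, and each statement
    about derivatives becomes a countable combination of such sets. Passing from rational to real
    covectors costs a factor in the quantitative form of independence, which is called coercivity
    here.

    The argument by contradiction needs a compact set with one coercivity constant. Inner regularity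
    finds it inside the set where the differential of v leaves the span, once this set is known to
    be Borel; the Gram matrices serve that purpose. *)

Section FirstOrder.
Context {R : realType} {X : metricType R}.
Implicit Types (f g h : X -> R) (x y z : X).

(** * First-order calculus of Lipschitz functions *)

Definition lip_with (k : R) (f : X -> R) : Prop :=
  0 <= k /\ forall x y, `|f x - f y| <= k * mdist x y.

(** Vanishing of the pointwise Lipschitz constant in epsilon form ([Lip_flat]), that is, f = f x +
    o(distance). *)
Definition flat f x : Prop := forall e, 0 < e ->
  exists2 r, 0 < r & forall y, mdist x y < r -> `|f y - f x| <= e * mdist x y.

Lemma mlipschitzP f : mlipschitz f <-> exists k, lip_with k f.
Proof.
split=> [[C fC]|[k [k0 fk]]]; last by exists k.
exists `|C|; split=> // x y; apply: le_trans (fC x y) _.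
by rewrite ler_wpM2r ?mdist_ge0// ler_norm.
Qed.

Lemma lip_withD k l f g : lip_with k f -> lip_with l g ->
  lip_with (k + l) (fun x => f x + g x).
Proof.
move=> [k0 fk] [l0 gl]; split=> [|x y]; first exact: addr_ge0.
rewrite opprD addrACA mulrDl (le_trans (ler_normD _ _))//.
exact: lerD.
Qed.

Lemma lip_withZ k f a : lip_with k f -> lip_with (`|a| * k) (fun x => a * f x).
Proof.
move=> [k0 fk]; split=> [|x y]; first exact: mulr_ge0.
by rewrite -mulrBr normrM -mulrA ler_wpM2l.
Qed.

Lemma lip_withN k f : lip_with k f -> lip_with k (fun x => - f x).
Proof. by move=> [k0 fk]; split=> // x y; rewrite -opprD normrN. Qed.

Lemma lip_withB k l f g : lip_with k f -> lip_with l g ->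
  lip_with (k + l) (fun x => f x - g x).
Proof.
by move=> fk gl; exact: lip_withD (lip_withN gl).
Qed.

Lemma lip_with_cst c : lip_with 0 (fun=> c).
Proof. by split=> // x y; rewrite subrr normr0 mul0r. Qed.

Lemma lip_mdist x : lip_with 1 (fun y => mdist y x).
Proof.
split=> // y z; rewrite mul1r ler_norml.
have := metric_triangle y z x; have := metric_triangle z y x.
by rewrite [mdist z y]metric_sym => *; apply/andP; split; lra.
Qed.

Lemma lip_with_le k l f : k <= l -> lip_with k f -> lip_with l f.
Proof.
move=> kl [k0 fk]; split=> [|x y]; first exact: le_trans kl.
by rewrite (le_trans (fk x y))// ler_wpM2r// mdist_ge0.
Qed.

Lemma flatD f g x : flat f x -> flat g x -> flat (fun y => f y + g y) x.
Proof.
move=> fx gx e e0; have e20 : 0 < e / 2 by rewrite divr_gt0.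
have [r r0 fr] := fx _ e20; have [s s0 gs] := gx _ e20.
exists (Num.min r s) => [|y]; first by rewrite lt_min r0.
rewrite lt_min => /andP[/fr fy /gs gy].
rewrite opprD addrACA (le_trans (ler_normD _ _))// [e]splitr mulrDl.
exact: lerD.
Qed.

Lemma flatZ f x a : flat f x -> flat (fun y => a * f y) x.
Proof.
move=> fx e e0; have [->|a0] := eqVneq a 0.
  by exists 1 => // y _; rewrite !mul0r subrr normr0 mulr_ge0 ?mdist_ge0// ltW.
have e1 : 0 < e / `|a| by rewrite divr_gt0// normr_gt0.
have [r r0 fr] := fx _ e1; exists r => // y /fr.
rewrite -mulrBr normrM => fy.
have := ler_wpM2l (normr_ge0 a) fy; rewrite mulrA mulrCA divff ?mulr1//.
by rewrite normr_eq0.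
Qed.

Lemma flatB f g x : flat f x -> flat g x -> flat (fun y => f y - g y) x.
Proof.
move=> fx gx; have := flatD fx (flatZ (-1) gx).
by under eq_fun do rewrite mulN1r.
Qed.

Lemma flat_near f g x r : 0 < r -> (forall y, mdist x y < r -> f y = g y) ->
  flat f x -> flat g x.
Proof.
move=> r0 fg fx e /fx[s s0 fs].
exists (Num.min r s) => [|y]; first by rewrite lt_min r0.
rewrite lt_min => /andP[yr /fs]; rewrite (fg _ yr) (fg x)//.
by rewrite mdistxx.
Qed.

(** [Lip] divides by the radius and [flat] by the distance. One direction takes the radius equal to
    the distance; the other uses that the distance is at most the radius. *)
Lemma Lip_flat f x : Lip f x = 0%E <-> flat f x.
Proof.
rewrite /Lip limf_esupE; set S := (X in ereal_inf X).
have at0 (V : set R) : (0 : R)^'+ V ->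
    exists2 d, 0 < d & forall r, 0 < r < d -> V r.
  move=> [d /= d0 dV]; exists d => // r /andP[r0 rd].
  by apply: dV => //=; rewrite sub0r normrN gtr0_norm.
split=> [S0 e e0|fx].
  have : (ereal_inf S < e%:E)%E by rewrite S0 lte_fin.
  move=> /ereal_inf_lt[_ [V /at0[d d0 dV] <-]] VE.
  exists d => // y yd.
  have [->|xy] := eqVneq x y; first by rewrite mdistxx mulr0 subrr normr0.
  have xy0 : 0 < mdist x y by rewrite mdist_gt0.
  rewrite -ler_pdivrMr// -lee_fin; apply: le_trans (ltW VE).
  apply: (@le_trans _ _ (ereal_sup [set (`|f z - f x| / mdist x y)%:E |
     z in [set z | mdist x z <= mdist x y]])).
    by apply: ereal_sup_ubound; exists y => /=.
  by apply: ereal_sup_ubound; exists (mdist x y) => //; apply: dV; rewrite xy0.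
apply/eqP; rewrite eq_le; apply/andP; split.
  apply/lee_addgt0Pr => e e0; rewrite add0e.
  have [r r0 fr] := fx _ e0.
  apply: (@le_trans _ _ (ereal_sup ((fun s : R => ereal_sup
      [set (`|f y - f x| / s)%:E | y in [set y | mdist x y <= s]]) @`
      [set s | 0 < s < r]))).
    apply: ereal_inf_lbound; exists [set s | 0 < s < r] => //.
    exists r => //= s /=; rewrite sub0r normrN => sr s0.
    by rewrite s0 (le_lt_trans (ler_norm _) sr).
  apply: ge_ereal_sup => _ [s /= /andP[s0 sr] <-].
  apply: ge_ereal_sup => _ [y /= ys <-].
  rewrite lee_fin ler_pdivrMr// (le_trans (fr _ (le_lt_trans ys sr)))//.
  by rewrite ler_wpM2l// ltW.
apply: le_ereal_inf_tmp => _ [V /at0[d d0 dV] <-].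
apply: (@le_trans _ _ (ereal_sup [set (`|f z - f x| / (d / 2))%:E |
     z in [set z | mdist x z <= d / 2]])).
  apply: (@le_trans _ _ (`|f x - f x| / (d / 2))%:E).
    by rewrite lee_fin subrr normr0 mul0r.
  by apply: ereal_sup_ubound; exists x => //=; rewrite mdistxx; lra.
by apply: ereal_sup_ubound; exists (d / 2) => //; apply: dV; lra.
Qed.

End FirstOrder.

Section Dot.
Context {R : realType} {n : nat}.
Implicit Types (c w : 'rV[R]_n).

Definition dot c w : R := \sum_i c ord0 i * w ord0 i.

Lemma dotDl c c' w : dot (c + c') w = dot c w + dot c' w.
Proof. by rewrite -big_split; apply: eq_bigr => i _; rewrite mxE mulrDl. Qed.

Lemma dotZl a c w : dot (a *: c) w = a * dot c w.
Proof. by rewrite mulr_sumr; apply: eq_bigr => i _; rewrite mxE mulrA. Qed.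

Lemma dotNl c w : dot (- c) w = - dot c w.
Proof. by rewrite -scaleN1r dotZl mulN1r. Qed.

Lemma dotBl c c' w : dot (c - c') w = dot c w - dot c' w.
Proof. by rewrite dotDl dotNl. Qed.

Lemma dotC c w : dot c w = dot w c.
Proof. by apply: eq_bigr => i _; rewrite mulrC. Qed.

Lemma dotBr c w w' : dot c (w - w') = dot c w - dot c w'.
Proof. by rewrite dotC dotBl ![dot _ c]dotC. Qed.

Lemma dot0l w : dot 0 w = 0.
Proof. by rewrite -(subrr 0) dotBl subrr. Qed.

Lemma ler_entry_norm m1 m2 (A : 'M[R]_(m1, m2)) i j : `|A i j| <= `|A|.
Proof.
rewrite [leRHS]/Num.norm /= mx_normrE; apply/bigmax_geP; right => /=.
by exists (i, j).
Qed.

Lemma norm_le_entry m1 m2 (A : 'M[R]_(m1, m2)) a : 0 <= a ->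
  (forall i j, `|A i j| <= a) -> `|A| <= a.
Proof.
move=> a0 Aa; rewrite [leLHS]/Num.norm /= mx_normrE.
by apply/bigmax_leP; split=> // -[i j] _; exact: Aa.
Qed.

Lemma ler_norm_dot c w : `|dot c w| <= n%:R * `|c| * `|w|.
Proof.
apply: le_trans (ler_norm_sum _ _ _) _.
have -> : n%:R * `|c| * `|w| = \sum_(i < n) `|c| * `|w|.
  by rewrite big_const_ord iter_addr addr0 -[RHS]mulr_natl mulrA.
by apply: ler_sum => i _; rewrite normrM ler_pM// ler_entry_norm.
Qed.

End Dot.

(** * Partial derivatives and coercivity *)

Section Partials.
Context {R : realType} {X : metricType R} {n : nat}.
Variable phi : X -> 'rV[R]_n.
Implicit Types (f g : X -> R) (x y z : X) (c : 'rV[R]_n).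

Lemma is_partialsP f x c :
  is_partials phi f x c <-> flat (fun y => f y - dot c (phi y)) x.
Proof.
have E y : f y - f x - \sum_i c ord0 i * (phi y ord0 i - phi x ord0 i) =
    f y - dot c (phi y) - (f x - dot c (phi x)).
  transitivity (f y - f x - dot c (phi y - phi x)).
    by congr (_ - _); apply: eq_bigr => i _; rewrite !mxE.
  by rewrite dotBr; ring.
rewrite /is_partials eqoP; split=> fx e e0.
  have /(@metricType_numDomainType.nbhs_mdistP R X)[r /= r0 rfx] := fx _ e0.
  exists r => // y /rfx /=; rewrite E => /le_trans; apply.
  by rewrite ger0_norm ?mdist_ge0// metric_sym.
have [r r0 fr] := fx _ e0.
apply/(@metricType_numDomainType.nbhs_mdistP R X).
exists r => //= y /fr; rewrite E => /le_trans; apply.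
by rewrite [X in _ <= _ * X]ger0_norm ?mdist_ge0// metric_sym.
Qed.

(** Quantitative independence: the pointwise Lipschitz constant at x of every combination
    [dot c (phi y)] is at least |c| / M. The strict inequality forces y to differ from x. *)
Definition coercive (M : R) x : Prop := forall c r, c != 0 -> 0 < r ->
  exists2 y, mdist x y < r &
    `|c| * mdist x y < M * `|dot c (phi y) - dot c (phi x)|.

(** The source of the bounds on covectors: two covectors that both approximate f near x differ by
    one with small increments there, hence by little. *)
Lemma coercive_le M x c l r : coercive M x -> 0 <= M -> 0 <= l -> 0 < r ->
  (forall y, mdist x y < r ->
    `|dot c (phi y) - dot c (phi x)| <= l * mdist x y) -> `|c| <= M * l.
Proof.
move=> Mx M0 l0 r0 cl; have [->|c0] := eqVneq c 0.
  by rewrite normr0 mulr_ge0.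
have [y yr] := Mx _ _ c0 r0; have := cl _ yr.
have := mdist_ge0 x y; rewrite le_eqVlt => /predU1P[<-|d0].
  by rewrite !mulr0 normr_le0 => /eqP ->; rewrite normr0 mulr0 ltxx.
move=> cly /lt_le_trans/(_ (ler_wpM2l M0 cly)).
by rewrite mulrA ltr_pM2r// => /ltW.
Qed.

Lemma ler_norm_partials M x f c l : coercive M x -> 0 <= M -> lip_with l f ->
  is_partials phi f x c -> `|c| <= M * l.
Proof.
move=> Mx M0 [l0 fl] /is_partialsP fc.
have H e : 0 < e -> `|c| <= M * (l + e).
  move=> e0; have [r r0 fr] := fc _ e0.
  apply: (coercive_le Mx M0 (addr_ge0 l0 (ltW e0)) r0) => y yr.
  rewrite mulrDl; have := fr _ yr; have := fl x y.
  rewrite [`|f x - f y|]distrC !ler_norml => /andP[h1 h2] /andP[h3 h4].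
  by apply/andP; split; lra.
apply/ler_addgt0Pr => e e0; apply: le_trans (H (e / (M + 1)) _) _.
  by rewrite divr_gt0// ltr_pwDr.
rewrite mulrDr lerD2l mulrCA ger_pMr// ler_pdivrMr ?ltr_pwDr//.
by rewrite mul1r lerDl.
Qed.

(** The difference of two derivatives is a derivative of the zero function, whose Lipschitz constant
    is 0. *)
Lemma is_partials_uniq M x f c c' : coercive M x -> 0 <= M ->
  is_partials phi f x c -> is_partials phi f x c' -> c = c'.
Proof.
move=> Mx M0 /is_partialsP fc /is_partialsP fc'.
apply/eqP; rewrite -subr_eq0 -normr_le0 -(mulr0 M).
apply: (ler_norm_partials (f := fun=> 0) Mx M0).
  exact: lip_with_cst.
apply/is_partialsP; have := flatB fc fc'.
by congr (flat _ x); apply/funext => y; rewrite dotBl; ring.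
Qed.

Lemma is_partials_lin f g x c c' a b :
  is_partials phi f x c -> is_partials phi g x c' ->
  is_partials phi (fun y => a * f y + b * g y) x (a *: c + b *: c').
Proof.
move=> /is_partialsP fc /is_partialsP gc'; apply/is_partialsP.
have := flatD (flatZ a fc) (flatZ b gc').
by congr (flat _ x); apply/funext => y; rewrite dotDl !dotZl; ring.
Qed.

Lemma is_partials_near f g x c r : 0 < r ->
  (forall y, mdist x y < r -> f y = g y) ->
  is_partials phi f x c -> is_partials phi g x c.
Proof.
move=> r0 fg /is_partialsP fc; apply/is_partialsP.
by apply: (flat_near r0 _ fc) => y /fg ->.
Qed.

(** The coefficient of f in the dependence relation is nonzero, since otherwise the relation would
    involve the components of phi alone. Dividing by it solves for f. *)
Lemma adjoin_partials f x : ~ dependent_at phi x ->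
  dependent_at (adjoin phi f) x -> exists c, is_partials phi f x c.
Proof.
move=> indep [c c0 /Lip_flat fc].
set a := c ord0 (rshift n ord0); set b := lsubmx c.
have E y : \sum_i c ord0 i * adjoin phi f y ord0 i = dot b (phi y) + a * f y.
  rewrite big_split_ord /= big_ord1; congr (_ + _).
    by apply: eq_bigr => i _; rewrite /adjoin row_mxEl /b mxE.
  by rewrite /adjoin row_mxEr mxE.
have {}fc : flat (fun y => dot b (phi y) + a * f y) x.
  by move: fc; congr (flat _ x); apply/funext => y; rewrite E.
have a0 : a != 0.
  apply/eqP => a0; apply: indep; exists b.
    apply: contra_neq c0 => b0.
    rewrite -[c]hsubmxK -/b b0; apply/matrixP => i j; rewrite !mxE.
    case: split_ordP => k jk; rewrite mxE//.
    by rewrite !ord1 -a0.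
  apply/Lip_flat; move: fc; congr (flat _ x); apply/funext => y.
  by rewrite a0 mul0r addr0.
exists (- a^-1 *: b); apply/is_partialsP.
have := flatZ a^-1 fc; congr (flat _ x); apply/funext => y.
by rewrite dotZl; field.
Qed.

Variable k : R.
Hypothesis k0 : 0 <= k.
Hypothesis phik : forall x y, `|phi x - phi y| <= k * mdist x y.

Lemma lip_dot c : lip_with (n%:R * k * `|c|) (fun y => dot c (phi y)).
Proof.
split=> [|x y]; first by rewrite !mulr_ge0.
rewrite -dotBr (le_trans (ler_norm_dot _ _))//.
rewrite [n%:R * k * _]mulrAC -[leRHS]mulrA.
by rewrite ler_wpM2l// mulr_ge0.
Qed.

(** Compactness of the unit sphere: unit covectors violating coercivity with constants tending to
    infinity accumulate at a unit covector, and this one is a dependence relation. *)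
Lemma independent_coercive x : ~ dependent_at phi x ->
  exists M : nat, coercive M.+1%:R x.
Proof.
move=> indep; apply: contrapT => /forallNP noM.
have /choice[u uP] (M : nat) : exists u, `|u| = 1 /\ exists2 r, 0 < r &
    forall y, mdist x y < r ->
    M.+1%:R * `|dot u (phi y) - dot u (phi x)| <= mdist x y.
  have /existsNP[c /existsNP[r]] := noM M.
  move=> /not_implyP[c0 /not_implyP[r0 /forall2NP cr]].
  have nc0 : 0 < `|c| by rewrite normr_gt0.
  exists (`|c|^-1 *: c); split.
    by rewrite normrZ normfV normr_id mulVf// gt_eqF.
  exists r => // y yr; have [//|/negP] := cr y; rewrite -leNgt => H.
  rewrite !dotZl -mulrBr normrM normfV normr_id mulrCA mulrC.
  by rewrite ler_pdivrMr// mulrC (mulrC (mdist x y)) mulrC.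
have Sc : compact [set v : 'rV[R]_n | `|v| = 1].
  apply: bounded_closed_compact.
    by exists 1; split=> // r r1 v /= ->; exact: ltW.
  apply: (@closed_comp _ _ (fun v : 'rV[R]_n => `|v|) [set 1]).
    by move=> v _; exact: norm_continuous.
  exact: closed_eq.
have [|c [c1 cP]] := Sc (u @ \oo) _.
  by exists 0%N => // M _ /=; have [] := uP M.
apply: indep; exists c; first by rewrite -normr_gt0 c1.
apply/Lip_flat => e e0.
have [N _ Ne] : \forall M \near \oo, M.+1%:R^-1 < e / 2.
  have e20 : 0 < e / 2 by rewrite divr_gt0.
  exact: (near_infty_natSinv_lt (PosNum e20)).
set K := n%:R * k; have K0 : 0 <= K by rewrite mulr_ge0.
have d0 : 0 < e / 2 / (K + 1) by rewrite divr_gt0 ?divr_gt0// ltr_pwDr.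
have [|v [[M /= NM <-] vc]] := cP [set u M | M in [set M | (N <= M)%N]]
    (ball c (e / 2 / (K + 1))) _ (nbhsx_ballx _ _ d0).
  by exists N => // M NM /=; exists M.
have {}vc : `|c - u M| < e / 2 / (K + 1) by rewrite -ball_normE in vc.
have [_ [r r0 ur]] := uP M; exists r => // y /ur yr.
have [_ /(_ y x) cu] := lip_dot (c - u M).
have -> : dot c (phi y) - dot c (phi x) = (dot (c - u M) (phi y) -
    dot (c - u M) (phi x)) + (dot (u M) (phi y) - dot (u M) (phi x)).
  by rewrite !dotBl; ring.
rewrite (le_trans (ler_normD _ _))// [e]splitr mulrDl lerD//.
  rewrite (le_trans cu)// metric_sym ler_wpM2r ?mdist_ge0//.
  apply: le_trans (ler_wpM2l K0 (ltW vc)) _.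
  rewrite mulrCA ger_pMr ?divr_gt0// ler_pdivrMr ?ltr_pwDr//.
  by rewrite mul1r lerDl.
rewrite -ler_pdivlMl// in yr; apply: le_trans yr _.
by rewrite ler_wpM2r ?mdist_ge0// ltW// Ne.

Qed.

End Partials.

(** * Borel measurability of partial derivatives *)

Section CountableQuantifiers.
Context {d} {T : measurableType d} {I : countType}.
Implicit Types (P : I -> T -> Prop).

Lemma measurable_exists P : (forall i, measurable [set x | P i x]) ->
  measurable [set x | exists i, P i x].
Proof.
move=> mP; rewrite (_ : [set x | _] = \bigcup_i [set x | P i x]).
  exact: countable_bigcupT_measurable.
by apply/seteqP; split=> [x [i Pi]|x [i _ Pi]]; exists i.
Qed.

Lemma measurable_forall P : (forall i, measurable [set x | P i x]) ->
  measurable [set x | forall i, P i x].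
Proof.
move=> mP; rewrite (_ : [set x | _] = ~` [set x | exists i, ~ P i x]).
  by apply/measurableC/measurable_exists => i; exact/measurableC/mP.
apply/seteqP; split=> [x Px [i]|x /forallNP Px i]; first exact.
exact: contrapT (Px i).
Qed.

End CountableQuantifiers.

Lemma measurable_imply {d} {T : measurableType d} (b : bool) (P : T -> Prop) :
  measurable [set x | P x] -> measurable [set x | b -> P x].
Proof.
case: b => mP; last by rewrite (_ : [set x | _] = setT)//; exact/seteqP.
by congr measurable : mP; apply/seteqP; split=> x /=; [move=> ? _|exact].
Qed.

Section RationalApproximation.
Context {R : realType}.

Definition ratv n (q : 'rV[rat]_n) : 'rV[R]_n := map_mx ratr q.

Lemma ratv_dense n (c : 'rV[R]_n) e : 0 < e -> exists q, `|c - ratv q| <= e.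
Proof.
move=> e0.
have /choice[q cq] i : exists q : rat, `|c ord0 i - ratr q| <= e.
  have /rat_in_itvoo[q] : c ord0 i - e < c ord0 i + e by lra.
  rewrite in_itv /= => /andP[h1 h2]; exists q.
  by rewrite ler_norml; apply/andP; split; lra.
exists (\row_i q i); apply: norm_le_entry (ltW e0) _ => i j.
by rewrite !mxE ord1.
Qed.

Lemma ratv_neq0 n (c : 'rV[R]_n) (q : 'rV[rat]_n) e : e < `|c| ->
  `|c - ratv q| <= e -> q != 0.
Proof.
move=> ec; apply: contraTneq => ->; rewrite -ltNge (lt_le_trans ec)//.
by rewrite /ratv map_mx0 subr0.
Qed.

Lemma invS_gt0 (j : nat) : 0 < j.+1%:R^-1 :> R.
Proof. by rewrite invr_gt0. Qed.

Lemma invS_lt (e : R) : 0 < e -> exists j : nat, j.+1%:R^-1 < e.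
Proof.
move=> e0; have [N _ Ne] := near_infty_natSinv_lt (PosNum e0).
by exists N; exact: Ne (leqnn N).
Qed.

Lemma invS_le (i j : nat) : (i <= j)%N -> j.+1%:R^-1 <= i.+1%:R^-1 :> R.
Proof. by move=> ij; rewrite lef_pV2 ?posrE// ler_nat. Qed.

End RationalApproximation.

Section BorelMeasurability.
Context {R : realType} {X : completeMetricType R}.
Implicit Types (f g h : X -> R) (x y : X).

Lemma open_borel (A : set X) : open A -> measurable (A : set (borel X)).
Proof. by move=> oA; exact: sub_sigma_algebra. Qed.

Lemma lip_continuous k f : lip_with k f -> continuous f.
Proof.
move=> [k0 fk] x; apply/cvgrPdist_le => e e0.
apply/(@metricType_numDomainType.nbhs_mdistP R X).
have K0 : 0 < k + 1 by rewrite ltr_pwDr.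
exists (e / (k + 1)); first by rewrite /= divr_gt0.
move=> y /=; rewrite ltr_pdivlMr// => xy; apply: le_trans (fk x y) _.
apply: le_trans (ltW xy); rewrite mulrC ler_wpM2l ?mdist_ge0//.
by rewrite lerDl.
Qed.

Lemma open_lip_gt0 k f : lip_with k f -> open [set x | 0 < f x].
Proof.
move=> /lip_continuous cf.
apply: (@open_comp _ _ f [set r | 0 < r]); first by move=> x _; exact: cf.
exact: open_gt.
Qed.

(** All three inequalities are strict, so that the set is open. Distances being nonnegative, a = -1
    removes the lower bound. *)
Definition steep f (l a b : R) : set X := [set x | exists y,
  [/\ a < mdist x y, mdist x y < b & l * mdist x y < `|f y - f x|]].

Lemma steep_open k f l a b : lip_with k f -> open (steep f l a b).
Proof.
move=> fk; rewrite (_ : steep f l a b = \bigcup_y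
    ([set x | 0 < mdist x y - a] `&` [set x | 0 < - mdist x y + b] `&`
     ([set x | 0 < (f y - f x) - l * mdist x y] `|`
      [set x | 0 < - (f y - f x) - l * mdist x y]))).
  have dy y := lip_mdist y.
  have Df y := lip_withB (lip_with_cst (f y)) fk.
  apply: bigcup_open => y _; apply: openI; first apply: openI.
  - exact: open_lip_gt0 (lip_withB (dy y) (lip_with_cst a)).
  - exact: open_lip_gt0 (lip_withD (lip_withN (dy y)) (lip_with_cst b)).
  - apply: openU.
      exact: open_lip_gt0 (lip_withB (Df y) (lip_withZ l (dy y))).
    exact: open_lip_gt0 (lip_withB (lip_withN (Df y)) (lip_withZ l (dy y))).
apply/seteqP; split=> [x [y [h1 h2 h3]]|x [y _ [[/= h1 h2] h3]]]; exists y => //.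
  split; first by split=> /=; lra.
  by move: h3; rewrite lter_normr => /orP[] h /=; [left|right]; lra.
split; [lra|lra|]; rewrite lter_normr.
by case: h3 => h /=; apply/orP; [left|right]; lra.
Qed.

Lemma not_steepP f l a b x : ~ steep f l a b x <->
  (forall y, a < mdist x y -> mdist x y < b ->
    `|f y - f x| <= l * mdist x y).
Proof.
split=> [nx y ay yb|H [y [ay yb]]]; last by rewrite ltNge H.
by rewrite leNgt; apply/negP => h; apply: nx; exists y.
Qed.

Lemma measurable_steep k f l a b : lip_with k f ->
  measurable (steep f l a b : set (borel X)).
Proof. by move=> fk; apply: open_borel; exact: steep_open fk. Qed.

End BorelMeasurability.

(** * Partial derivatives as Borel functions *)

Section MeasurablePartials.
Context {R : realType} {X : completeMetricType R} {n : nat}.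
Variables (phi : X -> 'rV[R]_n) (k : R).
Hypothesis k0 : 0 <= k.
Hypothesis phik : forall x y, `|phi x - phi y| <= k * mdist x y.
Implicit Types (f g h : X -> R) (x y : X) (c : 'rV[R]_n) (q : 'rV[rat]_n).

(** Coercivity tested on countably many covectors and radii, hence a Borel condition; it agrees with
    [coercive] up to a factor 3 in M. *)
Definition rat_coercive (M : R) x : Prop := forall q (j : nat), q != 0 ->
  steep (fun y => dot (ratv q) (phi y)) (`|ratv q : 'rV[R]_n| / M)
    (-1) j.+1%:R^-1 x.

Lemma measurable_rat_coercive M :
  measurable (rat_coercive M : set (borel X)).
Proof.
apply: measurable_forall => q; apply: measurable_forall => j.
by apply: measurable_imply; exact: measurable_steep (lip_dot k0 phik _).
Qed.

Lemma coercive_rat M x : 0 < M -> coercive phi M x -> rat_coercive M x.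
Proof.
move=> M0 Mx q j q0; have rq0 : ratv q != 0 :> 'rV[R]_n.
  by rewrite /ratv map_mx_eq0.
have [y yj yM] := Mx _ _ rq0 (invS_gt0 j).
exists y; split=> //; first by rewrite (lt_le_trans _ (mdist_ge0 _ _))// ltrN10.
by rewrite mulrAC ltr_pdivrMr// [ltRHS]mulrC.
Qed.

Lemma rat_coercive_coercive M x : 0 < M -> rat_coercive M x ->
  coercive phi (3 * M) x.
Proof.
move=> M0 Mx c r c0 r0; have nc : 0 < `|c| by rewrite normr_gt0.
pose K := n%:R * k; have K0 : 0 <= K by rewrite mulr_ge0.
(* The loss e in the norm of c and the loss M K e in its increments add up to |c| / 6. *)
pose e := `|c| / (6 * (M * K + 1)).
have MK1 : 0 < M * K + 1 by rewrite ltr_pwDr// mulr_ge0// ltW.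
have e0 : 0 < e by rewrite divr_gt0// mulr_gt0.
have eE : 6 * (M * K + 1) * e = `|c|.
  by rewrite /e mulrC divfK// gt_eqF// mulr_gt0.
have [q cq] := ratv_dense c e0.
have ec : e < `|c|.
  have : 0 <= M * K * e by apply: mulr_ge0; [apply: mulr_ge0|]; lra.
  by rewrite -eE => ?; lra.
have q0 : q != 0 by exact: ratv_neq0 ec cq.
have [j jr] := invS_lt r0.
have [y [_ yj yM]] := Mx q j q0; exists y; first exact: lt_trans jr.
move: yM; rewrite mulrAC ltr_pdivrMr// => yM.
have h1 : `|dot c (phi y) - dot c (phi x)| >=
    `|dot (ratv q) (phi y) - dot (ratv q) (phi x)| - K * e * mdist x y.
  have [_ /(_ y x)] := lip_dot k0 phik (c - ratv q).
  rewrite !dotBl -/K [mdist y x]metric_sym => h.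
  have {}h : `|dot c (phi y) - dot (ratv q) (phi y) -
      (dot c (phi x) - dot (ratv q) (phi x))| <= K * e * mdist x y.
    by rewrite (le_trans h)// ler_wpM2r ?mdist_ge0// ler_wpM2l.
  rewrite lerBlDr -lerBlDl; apply: le_trans h.
  rewrite (le_trans (lerB_dist _ _))// -normrN.
  by rewrite le_eqVlt; apply/orP; left; apply/eqP; congr `|_|; ring.
have h2 : `|ratv q : 'rV[R]_n| >= `|c| - e.
  by rewrite lerBlDr -lerBlDl (le_trans _ cq)// lerB_dist.
have d0 : 0 < mdist x y.
  rewrite lt_neqAle mdist_ge0 andbT; apply/eqP => d0.
  move: yM; rewrite -d0 mulr0.
  have /mdist_positivity -> : mdist x y = 0 by rewrite -d0.
  by rewrite subrr normr0 mul0r ltxx.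
set Dc := `|dot c _ - _| in h1 *.
set Dq := `|dot (ratv q) _ - _| in h1 yM.
have p1 : 0 <= M * (Dc - Dq + K * e * mdist x y).
  by apply: mulr_ge0; [exact: ltW|lra].
have p2 : 0 <= mdist x y * (`|ratv q| - `|c| + e).
  by apply: mulr_ge0; [exact: ltW|lra].
have p3 : 6 * (M * K + 1) * e * mdist x y = `|c| * mdist x y by rewrite eE.
have p4 : 0 < `|c| * mdist x y by rewrite mulr_gt0.
lra.
Qed.

Lemma partialsP f x : (exists c, is_partials phi f x c) ->
  is_partials phi f x (partials phi f x).
Proof. by move=> ?; exact: xgetPex. Qed.

(** A partial derivative exceeds t exactly when some rational q, whose entry exceeds t by a margin,
    approximates f near x up to a slope em. The derivative approximates f at least as well at still
    smaller distances, so it differs from q by increments of slope at most 2 em; coercivity with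
    constant 3 M turns this into the margin 6 M em. *)
Lemma measurable_partials (G : set (borel X)) l f : measurable G ->
  lip_with l f ->
  (forall x, G x -> exists M : nat, coercive phi M.+1%:R x) ->
  (forall x, G x -> exists c, is_partials phi f x c) ->
  forall i, measurable_fun G (fun x : borel X => partials phi f x ord0 i).
Proof.
move=> mG fl GM Gf i.
pose K := n%:R * k; have K0 : 0 <= K by rewrite mulr_ge0.
apply: (measurability _ (RGenOInfty.measurableE R)) => // _ [_ [t ->] <-].
pose P M m j q x := [/\ rat_coercive M.+1%:R x,
  ~ steep (fun y => f y - dot (ratv q) (phi y)) m.+1%:R^-1 (-1) j.+1%:R^-1 x &
  t + 6 * (M.+1%:R * m.+1%:R^-1) < ratr (q ord0 i)].
rewrite (_ : _ `&` _ = G `&`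
    [set x | exists M, exists m, exists j, exists q, P M m j q x]).
  apply: measurableI => //.
  apply: measurable_exists => M; apply: measurable_exists => m.
  apply: measurable_exists => j; apply: measurable_exists => q.
  rewrite (_ : [set x | P M m j q x] = rat_coercive M.+1%:R `&`
     ~` steep (fun y => f y - dot (ratv q) (phi y)) m.+1%:R^-1 (-1) j.+1%:R^-1
     `&` [set _ | t + 6 * (M.+1%:R * m.+1%:R^-1) < ratr (q ord0 i)]); last first.
    by apply/seteqP; split=> [x [h1 h2 h3]|x [[h1 h2] h3]]; split.
  apply: measurableI; first apply: measurableI.
  - exact: measurable_rat_coercive.
  - by apply: measurableC; exact: measurable_steep (lip_withB fl (lip_dot k0 phik _)).
  - by case: (_ < _); rewrite ?set_true ?set_false.
apply/seteqP; split=> x [Gx xP]; split=> //; last first.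
  move: xP => [M [m [j [q [Mx ns tq]]]]] /=.
  have M0 : 0 < M.+1%:R :> R by [].
  have cM := rat_coercive_coercive M0 Mx.
  have /is_partialsP fx := partialsP (Gf _ Gx).
  have [r r0 fr] := fx _ (invS_gt0 m).
  have cq : `|partials phi f x - ratv q| <= (3 * M.+1%:R) * (2 * m.+1%:R^-1).
    have s0 : 0 < Num.min r j.+1%:R^-1 by rewrite lt_min r0 invS_gt0.
    apply: (coercive_le cM _ _ s0); [lra| |].
      by rewrite mulr_ge0// ltW.
    move=> y; rewrite lt_min => /andP[/fr h1 yj].
    have := (not_steepP _ _ _ _ _).1 ns y (lt_le_trans _ (mdist_ge0 _ _)) yj.
    rewrite ltrN10 => /(_ isT) h2; rewrite !dotBl.
    move: h1 h2; move: (m.+1%:R^-1) => em.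
    rewrite !ler_norml => /andP[? ?] /andP[? ?].
    by apply/andP; split; lra.
  have := le_trans (ler_entry_norm _ ord0 i) cq.
  move: tq; move: (m.+1%:R^-1) => em tq.
  rewrite !mxE in_itv /= andbT ler_norml => /andP[h1 h2].
  rewrite -/(partials phi f x ord0 i) in h1 h2 *; lra.
move: xP; rewrite /= in_itv /= andbT => tc.
have [M Mx] := GM _ Gx; have /is_partialsP fx := partialsP (Gf _ Gx).
(* Half of the excess of the derivative over t pays for the distance to q, the other half for the
   margin. *)
set c := partials phi f x in tc fx; set e := (c ord0 i - t) / 2.
have e0 : 0 < e by rewrite /e; lra.
have M0 : 0 < M.+1%:R :> R by [].
have [m me] : exists m : nat, m.+1%:R^-1 < e / (6 * M.+1%:R).
  by apply: invS_lt; rewrite divr_gt0// mulr_gt0.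
have m0 : 0 < m.+1%:R^-1 :> R := invS_gt0 m; set em := m.+1%:R^-1 in me m0.
have s0 : 0 < Num.min e (em / 2 / (K + 1)).
  by rewrite lt_min e0 !divr_gt0// ltr_pwDr.
have [q cq] := ratv_dense c s0.
have [r r0 fr] := fx _ (divr_gt0 m0 (ltr0Sn R 1)).
have [j jr] := invS_lt r0.
exists M, m, j, q; split.
- exact: coercive_rat.
- apply/not_steepP => y _ yj; have := fr _ (lt_trans yj jr).
  have [_ /(_ y x)] := lip_dot k0 phik (c - ratv q).
  rewrite !dotBl -/K [mdist y x]metric_sym => h1 h2.
  have h3 : K * `|c - ratv q| <= em / 2.
    have h4 : `|c - ratv q| <= em / 2 / (K + 1).
      by rewrite (le_trans cq)// ge_min lexx orbT.
    apply: le_trans (ler_wpM2l K0 h4) _; rewrite mulrCA ger_pMr ?divr_gt0//.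
    by rewrite ler_pdivrMr ?ltr_pwDr// mul1r lerDl.
  have {h3}h1 := le_trans h1 (ler_wpM2r (mdist_ge0 x y) h3).
  move: h1 h2; rewrite -/em !ler_norml; clearbody em.
  by move=> /andP[? ?] /andP[? ?]; apply/andP; split; lra.
- have h : `|(c - ratv q) ord0 i| <= e.
    by rewrite (le_trans (ler_entry_norm _ _ _))// (le_trans cq)// ge_min lexx.
  rewrite -/em; move: me h; rewrite ltr_pdivlMr ?mulr_gt0// !mxE ler_norml.
  rewrite /e; clearbody em; move: (M.+1%:R : R) => MR me /andP[h1 h2].
  by rewrite -/c in h2; lra.
Qed.

End MeasurablePartials.

(** * A nowhere differentiable Lipschitz function *)

Section MeasureExhaustion.
Context {d} {T : measurableType d} {R : realType}.
Variable mu : {measure set T -> \bar R}.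

Lemma exhaustion (K : set T) (P : nat -> set T) (e : R) :
  measurable K -> (mu K < +oo)%E -> (forall m, measurable (P m)) ->
  (forall m p, (m <= p)%N -> P m `<=` P p) -> K `<=` \bigcup_m P m -> 0 < e ->
  exists m, (mu (K `\` P m) <= e%:E)%E.
Proof.
move=> mK Koo mP ndP KP e0; apply: contrapT => /forallNP He.
have F0 : \bigcap_m (K `\` P m) = set0.
  apply/seteqP; split=> // x h; have [Kx _] := h 0%N Logic.I.
  by have [m _ Pm] := KP _ Kx; have [_] := h m Logic.I.
have mF m : measurable (K `\` P m) by exact: measurableD.
have cv : (mu \o (fun m => K `\` P m)) x @[x --> \oo] --> mu (\bigcap_m (K `\` P m)).
  apply: nonincreasing_cvg_mu => //.
  - by rewrite (le_lt_trans _ Koo)// le_measure ?inE//; exact: subDsetl.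
  - by rewrite F0.
  - by move=> m p mp; apply/subsetPset; apply: setDS; exact: ndP.
have : (e%:E <= mu (\bigcap_m (K `\` P m)))%E.
  rewrite -(cvg_lim _ cv)//; apply: lime_ge; first by apply/cvg_ex; eexists; exact: cv.
  by apply: nearW => m; have /negP := He m; rewrite -ltNge => /ltW.
by rewrite F0 measure0 lee_fin leNgt e0.
Qed.

(** The losses sum to at most e, which is less than the measure of K. *)
Lemma bigcap_gt0 (K : set T) (E : nat -> set T) (e : R) :
  measurable K -> (forall m, measurable (E m)) -> (e%:E < mu K)%E -> 0 < e ->
  (forall m, mu (K `\` E m) <= (e / (2 ^ m.+1)%:R)%:E)%E ->
  (0 < mu (K `&` \bigcap_m E m))%E.
Proof.
move=> mK mE eK e0 HE; rewrite lt_neqAle measure_ge0 andbT eq_sym.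
apply/negP => /eqP K0; move: eK; apply/negP; rewrite -leNgt.
have mI : measurable (\bigcap_m E m) by exact: bigcapT_measurable.
have -> : (mu K = mu (K `\` \bigcap_m E m) + mu (K `&` \bigcap_m E m))%E.
  exact: measureDI.
rewrite K0 adde0 setDE setC_bigcap setI_bigcupr.
have mD m : measurable (K `&` ~` E m) by apply: measurableI => //; exact: measurableC.
apply: (@le_trans _ _ (\sum_(0 <= m <oo) mu (K `&` ~` E m)))%E.
  by apply: measure_sigma_subadditive => //; exact: bigcupT_measurable.
apply: le_trans (epsilon_trick0 xpredT (ltW e0)).
by apply: lee_nneseries => // m _; rewrite -setDE; exact: HE.
Qed.

End MeasureExhaustion.

Section Limits.
Context {R : realType}.

Lemma half_expn_lt (e : R) : 0 < e ->
  exists N, forall j, (N <= j)%N -> 2^-1 ^+ j < e.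
Proof.
move=> e0; have [N _ Ne] := near_infty_natSinv_expn_lt (PosNum e0).
by exists N => j /Ne /=; rewrite exprVn div1r.
Qed.

Lemma cvg_bound (u b : nat -> R) :
  (forall i m, (i <= m)%N -> `|u m - u i| <= b i) ->
  (forall e, 0 < e -> exists i, b i < e) ->
  exists l, forall i, `|l - u i| <= b i.
Proof.
move=> ub b0; have cu : cvg (u @ \oo).
  apply/cauchy_cvgP/cauchy_exP => e e0; have [i bi] := b0 _ e0.
  exists (u i), i => // m /= im; rewrite -ball_normE /= distrC.
  exact: le_lt_trans (ub _ _ im) bi.
exists (lim (u @ \oo)) => i; rewrite ler_norml; apply/andP; split.
  rewrite lerBrDr; apply: limr_ge => //; exists i => // m /= im.
  by have := ub _ _ im; rewrite ler_norml => /andP[h1 h2]; lra.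
rewrite lerBlDr; apply: limr_le => //; exists i => // m /= im.
by have := ub _ _ im; rewrite ler_norml => /andP[h1 h2]; lra.
Qed.

Lemma cvg_bound_row n (u : nat -> 'rV[R]_n) (b : nat -> R) :
  (forall i m, (i <= m)%N -> `|u m - u i| <= b i) ->
  (forall e, 0 < e -> exists i, b i < e) ->
  exists l, forall i, `|l - u i| <= b i.
Proof.
move=> ub b0.
have /choice[l lP] (j : 'I_n) : exists l, forall i, `|l - u i ord0 j| <= b i.
  apply: cvg_bound => // i m im; apply: le_trans (ub _ _ im).
  by rewrite (_ : _ - _ = (u m - u i) ord0 j) ?ler_entry_norm// !mxE.
exists (\row_j l j) => i; apply: norm_le_entry.
  by apply: le_trans (ub i i (leqnn _)); exact: normr_ge0.
by move=> i0 j; rewrite !mxE ord1; exact: lP.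
Qed.

(** The subtracted term is what lets the induction on m close. *)
Lemma geometric_dist (V : normedModType R) (u : nat -> V) :
  (forall j, `|u j.+1 - u j| <= 2^-1 ^+ j) ->
  forall i m, (i <= m)%N -> `|u m - u i| <= 2 * (2^-1 ^+ i - 2^-1 ^+ m).
Proof.
move=> uS i; elim=> [|m IH].
  by rewrite leqn0 => /eqP ->; rewrite !subrr normr0 mulr0.
rewrite leq_eqVlt => /predU1P[->|im]; first by rewrite !subrr normr0 mulr0.
rewrite -[_ - _](subrKA (u m)) (le_trans (ler_normD _ _))//.
by have := uS m; have := IH im; rewrite exprSr; lra.
Qed.

Lemma geometric_cvg_row n (u : nat -> 'rV[R]_n) :
  (forall j, `|u j.+1 - u j| <= 2^-1 ^+ j) ->
  exists l, forall i, `|l - u i| <= 2 * 2^-1 ^+ i.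
Proof.
move=> uS; apply: cvg_bound_row => [i m im|e e0].
  apply: le_trans (geometric_dist uS im) _.
  by rewrite ler_wpM2l// gerBl exprn_ge0.
have e2 : 0 < e / 2 by rewrite divr_gt0.
have [N Ne] := half_expn_lt e2; exists N.
by have := Ne _ (leqnn N); rewrite ltr_pdivlMr// mulrC.
Qed.

End Limits.

(** * Lipschitz envelope of a function that is Lipschitz from one point *)

Section Envelope.
Context {R : realType} {X : completeMetricType R}.
Variables (f : X -> R) (b C : R).
Hypotheses (fb : forall y, `|f y| <= b) (C0 : 0 <= C).

Definition envelope (y : X) : R := inf [set f z + C * mdist y z | z in setT].

Let S_lb y : lbound [set f z + C * mdist y z | z in setT] (- b).
Proof.
move=> _ [z _ <-]; have := fb z; rewrite ler_norml => /andP[h _].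
by rewrite (le_trans h)// lerDl mulr_ge0// mdist_ge0.
Qed.

Lemma envelope_le y z : envelope y <= f z + C * mdist y z.
Proof. by apply: ge_inf; [exists (- b); exact: S_lb|exists z]. Qed.

Lemma envelope_ge y a : (forall z, a <= f z + C * mdist y z) -> a <= envelope y.
Proof.
move=> ha; apply: lb_le_inf; first by exists (f y + C * mdist y y); exists y.
by move=> _ [z _ <-].
Qed.

Lemma lip_envelope : lip_with C envelope.
Proof.
have H y z : envelope y <= envelope z + C * mdist y z.
  rewrite -lerBlDr; apply: envelope_ge => w; rewrite lerBlDr.
  rewrite (le_trans (envelope_le y w))// -addrA lerD2l -mulrDr ler_wpM2l//.
  by rewrite addrC metric_triangle.
split=> // y z; rewrite ler_norml; have := H y z; have := H z y.
by rewrite [mdist z y]metric_sym => *; apply/andP; split; lra.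
Qed.

(** The penalty 4 C' leaves f x unchanged and the envelope below f, so only the lower bound is at
    stake. A competitor z within s of x costs at most C' through g and C' through eta per unit of
    [mdist y z]. A competitor beyond s is at least 4 times as far from x as y is, and its penalty
    outweighs both its gain and the increment of g; this is why the radius shrinks to s / 4. *)
Lemma envelope_approx x (g : X -> R) C' G s eta t : C = 4 * C' ->
  (forall y, `|f y - f x| <= C' * mdist x y) ->
  (forall y z, `|g y - g z| <= G * mdist y z) -> 0 <= G -> G <= C' ->
  0 <= eta -> eta <= C' -> 0 <= t ->
  (forall z, mdist x z < s ->
    `|f z - f x - (g z - g x)| <= eta * (mdist x z + t)) ->
  forall y, mdist x y < s / 4 ->
    `|envelope y - envelope x - (g y - g x)| <= eta * (mdist x y + t).
Proof.
move=> CE fx gG G0 GC eta0 etaC t0 fg y ys.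
have C'0 : 0 <= C' by exact: le_trans GC.
have -> : envelope x = f x.
  apply/eqP; rewrite eq_le; apply/andP; split.
    by have := envelope_le x x; rewrite mdistxx mulr0 addr0.
  apply: envelope_ge => z; have := fx z; rewrite ler_norml => /andP[h _].
  have := mulr_ge0 C'0 (mdist_ge0 x z); rewrite CE; lra.
have dxy := mdist_ge0 x y.
rewrite ler_norml; apply/andP; split; last first.
  have := fg y; rewrite ler_norml => /(_ _)/andP[|_ h]; first lra.
  by have := envelope_le y y; rewrite mdistxx mulr0 addr0 => ?; lra.
suff : f x + (g y - g x) - eta * (mdist x y + t) <= envelope y by lra.
apply: envelope_ge => z; have dyz := mdist_ge0 y z.
have tri := metric_triangle x y z; have tri' := metric_triangle x z y.
rewrite [mdist z y]metric_sym in tri'.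
have [zs|zs] := ltP (mdist x z) s.
  have := fg z zs; rewrite ler_norml => /andP[h _].
  have := gG y z; rewrite ler_norml => /andP[_ h2].
  have h3 : eta * mdist x z <= eta * (mdist x y + mdist y z).
    by rewrite ler_wpM2l.
  have h4 : G * mdist y z <= C' * mdist y z by rewrite ler_wpM2r.
  have h5 : eta * mdist y z <= C' * mdist y z by rewrite ler_wpM2r.
  have h6 := mulr_ge0 C'0 dyz.
  rewrite CE; lra.
have := fx z; rewrite ler_norml => /andP[h _].
have := gG y x; rewrite ler_norml [mdist y x]metric_sym => /andP[_ h2].
have h3 : G * mdist x y <= C' * mdist x y by rewrite ler_wpM2r.
have h4 : C' * mdist x z <= C' * (mdist x y + mdist y z) by rewrite ler_wpM2l.
have h5 : C' * (4 * mdist x y) <= C' * mdist x z.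
  by rewrite ler_wpM2l//; lra.
have h7 : 0 <= C' * mdist x y by rewrite mulr_ge0.
have h6 : 0 <= eta * (mdist x y + t) by rewrite mulr_ge0// addr_ge0.
rewrite CE; lra.
Qed.

End Envelope.

(** * Uniform scales for linearity and for detection, off a small set *)

Section Stage.
Context {R : realType} {X : completeMetricType R} {n : nat}.
Variables (phi : X -> 'rV[R]_n) (k : R).
Hypothesis k0 : 0 <= k.
Hypothesis phik : forall x y, `|phi x - phi y| <= k * mdist x y.
Variable mu : {measure set (borel X) -> \bar R}.
Variables (K : set (borel X)) (M : R).
Hypotheses (mK : measurable K) (Koo : (mu K < +oo)%E).
Hypotheses (M0 : 0 < M) (KM : forall x, K x -> coercive phi M x).

(** An Egorov argument. The exhausting sets are described by rational covectors, so they are Borel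
    whatever the selection C. At their points coercivity gives |C x - q| <= 2 M ep, which explains
    the constant. *)
Lemma uniform_linearization (f : X -> R) l (C : X -> 'rV[R]_n) (ep e : R) :
  lip_with l f -> (forall x, K x -> is_partials phi f x (C x)) ->
  0 < ep -> 0 < e -> exists s (E : set (borel X)), [/\ 0 < s, measurable E,
    (mu (K `\` E) <= e%:E)%E & forall x, K x -> E x -> forall y, mdist x y < s ->
    `|f y - f x - (dot (C x) (phi y) - dot (C x) (phi x))| <=
      (1 + 2 * (n%:R * k * M)) * ep * mdist x y].
Proof.
move=> fl fC ep0 e0.
pose h q (y : X) := f y - dot (ratv q) (phi y).
have hl q : lip_with (l + n%:R * k * `|ratv q : 'rV[R]_n|) (h q).
  exact: lip_withB fl (lip_dot k0 phik _).
pose P m := [set x : borel X | exists q, ~ steep (h q) ep (-1) m.+1%:R^-1 x].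
have mP m : measurable (P m).
  apply: measurable_exists => q; apply: measurableC.
  exact: measurable_steep (hl q).
have nkC q x y : `|dot (C x - ratv q) (phi y) - dot (C x - ratv q) (phi x)| <=
    n%:R * k * `|C x - ratv q| * mdist x y.
  by have [_ /(_ y x)] := lip_dot k0 phik (C x - ratv q); rewrite metric_sym.
have nk0 : 0 <= n%:R * k by rewrite mulr_ge0.
have [|||m Em] := exhaustion (e := e) mK Koo mP.
- move=> m p mp x [q qx]; exists q; apply/not_steepP => y y1 yp.
  by apply: (not_steepP _ _ _ _ _).1 qx _ y1 (lt_le_trans yp (invS_le mp)).
- move=> x Kx; have /is_partialsP fx := fC _ Kx.
  have [r r0 fr] := fx _ (divr_gt0 ep0 (ltr0Sn R 1)).
  have [m mr] := invS_lt r0.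
  have s0 : 0 < ep / 2 / (n%:R * k + 1) by rewrite !divr_gt0// ltr_pwDr.
  have [q cq] := ratv_dense (C x) s0.
  exists m => //; exists q; apply/not_steepP => y _ ym.
  have h1 := fr _ (lt_trans ym mr); have h2 := nkC q x y.
  have h3 : n%:R * k * `|C x - ratv q| <= ep / 2.
    apply: le_trans (ler_wpM2l nk0 cq) _; rewrite mulrCA ger_pMr ?divr_gt0//.
    by rewrite ler_pdivrMr ?ltr_pwDr// mul1r lerDl.
  have {h3}h2 := le_trans h2 (ler_wpM2r (mdist_ge0 x y) h3).
  move: h1 h2; rewrite /h !dotBl !ler_norml.
  by move=> /andP[? ?] /andP[? ?]; apply/andP; split; lra.
- exact: e0.
exists m.+1%:R^-1, (P m); split=> // x Kx [q qx] y ym.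
have qy := (not_steepP _ _ _ _ _).1 qx.
have d1 z : -1 < mdist x z by rewrite (lt_le_trans _ (mdist_ge0 _ _))// ltrN10.
have /is_partialsP fx := fC _ Kx; have [r r0 fr] := fx _ ep0.
have s0 : 0 < Num.min r m.+1%:R^-1 by rewrite lt_min r0 invS_gt0.
have cq : `|C x - ratv q| <= M * (2 * ep).
  apply: (coercive_le (KM Kx) (ltW M0) _ s0); first by rewrite mulr_ge0// ltW.
  move=> z; rewrite lt_min => /andP[/fr h1 zm].
  have := qy z (d1 z) zm; move: h1; rewrite /h !dotBl !ler_norml.
  by move=> /andP[? ?] /andP[? ?]; apply/andP; split; lra.
have h1 := qy y (d1 y) ym; have h2 := nkC q x y.
have {h2}h2 := le_trans h2 (ler_wpM2r (mdist_ge0 x y) (ler_wpM2l nk0 cq)).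
move: h1 h2; rewrite /h !dotBl !ler_norml.
by move=> /andP[? ?] /andP[? ?]; apply/andP; split; lra.
Qed.

(** Coercivity yields witnesses within s of x, possibly very close to it. For finitely many
    covectors they stay at a distance t from x that is common to all x off a small set. *)
Lemma uniform_detection (j : nat) (s e : R) : 0 < s -> 0 < e ->
  exists t (E : set (borel X)), [/\ 0 < t, t < s, measurable E,
    (mu (K `\` E) <= e%:E)%E & forall x, E x ->
    forall q : 'rV[rat]_n, q != 0 -> (pickle q < j)%N -> exists y,
      [/\ t < mdist x y, mdist x y < s & `|ratv q : 'rV[R]_n| * mdist x y <
        M * `|dot (ratv q) (phi y) - dot (ratv q) (phi x)|]].
Proof.
move=> s0 e0; pose g q (y : X) := dot (ratv q) (phi y).
pose st q a := steep (g q) (`|ratv q : 'rV[R]_n| / M) a s.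
pose P m := [set x : borel X | forall q : 'rV[rat]_n,
  (q != 0) && (pickle q < j)%N -> st q m.+1%:R^-1 x].
have mP m : measurable (P m).
  apply: measurable_forall => q; apply: measurable_imply.
  exact: measurable_steep (lip_dot k0 phik _).
have stS q x m p : (m <= p)%N -> st q m.+1%:R^-1 x -> st q p.+1%:R^-1 x.
  move=> mp [y [y1 y2 y3]]; exists y; split=> //.
  exact: le_lt_trans (invS_le mp) y1.
have [|||m Em] := exhaustion (e := e) mK Koo mP.
- by move=> m p mp x Px q qj; apply: stS mp _; exact: Px.
- move=> x Kx.
  have /choice[m mP'] (q : 'rV[rat]_n) : exists m : nat, q != 0 ->
      st q m.+1%:R^-1 x.
    have [->|q0] := eqVneq q 0; first by exists 0%N.
    have rq0 : ratv q != 0 :> 'rV[R]_n by rewrite /ratv map_mx_eq0.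
    have [y ys yM] := KM Kx rq0 s0.
    have d0 : 0 < mdist x y.
      rewrite lt_neqAle mdist_ge0 andbT; apply/eqP => d0; move: yM.
      have /mdist_positivity <- : mdist x y = 0 by rewrite -d0.
      by rewrite mdistxx subrr normr0 !mulr0 ltxx.
    have [m md] := invS_lt d0; exists m => _; exists y; split=> //.
    by rewrite mulrAC ltr_pdivrMr// [ltRHS]mulrC.
  (* The covectors concerned are those with code below j; codes of no covector count as 0. *)
  exists (\max_(i < j) oapp m 0%N (unpickle i)) => // q /andP[q0 qj].
  apply: stS (mP' q q0).
  apply: leq_trans (leq_bigmax (Ordinal qj)).
  by rewrite /= pickleK.
- exact: e0.
have [p ps] := invS_lt s0.
exists (maxn m p).+1%:R^-1, (P m); split=> //.
  by rewrite (le_lt_trans _ ps)// invS_le// leq_maxr.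
move=> x Px q q0 qj; have /Px : (q != 0) && (pickle q < j)%N by rewrite q0.
move=> [y [y1 y2 y3]]; exists y; split=> //.
  by rewrite (le_lt_trans _ y1)// invS_le// leq_maxl.
by move: y3; rewrite mulrAC ltr_pdivrMr// [X in _ < X -> _]mulrC.
Qed.

End Stage.

(** * The alternating sum and its oscillating slopes *)

Section AlternatingLimit.
Context {R : realType} {X : completeMetricType R} {n : nat}.
Variables (phi : X -> 'rV[R]_n) (k : R).
Hypothesis k0 : 0 <= k.
Hypothesis phik : forall x y, `|phi x - phi y| <= k * mdist x y.
Variables (F : nat -> X -> R) (T S : nat -> R) (L : R).
Local Notation hp j := (2^-1 ^+ j : R).
Hypotheses (L0 : 0 <= L) (T0 : T 0%N = 1).
Hypotheses (Tgt0 : forall j, 0 < T j) (TS : forall j, T j.+1 < S j.+1).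
Hypotheses (ST : forall j, S j.+1 <= T j) (Shp : forall j, S j.+1 <= hp j).
Hypothesis F0 : forall y, F 0%N y = 0.
Hypothesis FS : forall j y, `|F j.+1 y - F j y| <= hp j * T j.
Hypothesis FL : forall j, lip_with L (fun y => F j.+1 y - F j y).

Let hp0 j : 0 < hp j.
Proof. by rewrite exprn_gt0. Qed.

Let hpge j : 0 <= hp j.
Proof. exact: ltW. Qed.

Let Tge j : 0 <= T j.
Proof. exact: ltW. Qed.

Let hpS j : hp j.+1 = hp j / 2.
Proof. by rewrite exprSr. Qed.

Let hp1 j : hp j <= 1.
Proof. by rewrite exprn_ile1// invf_le1// ler1n. Qed.

Let T_le i j : (i <= j)%N -> T j <= T i.
Proof.
elim: j => [|j IH]; first by rewrite leqn0 => /eqP ->.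
rewrite leq_eqVlt => /predU1P[->//|ij].
by rewrite (le_trans (ltW (TS j)))// (le_trans (ST j))// IH.
Qed.

Lemma alternating_limit : exists f : X -> R,
  forall y i, `|f y - F i y| <= 2 * hp i * T i.
Proof.
have H y i m : (i <= m)%N -> `|F m y - F i y| <= 2 * (hp i - hp m) * T i.
  elim: m => [|m IH].
    by rewrite leqn0 => /eqP ->; rewrite !subrr normr0 mulr0 mul0r.
  rewrite leq_eqVlt => /predU1P[->|im].
    by rewrite !subrr normr0 mulr0 mul0r.
  have -> : F m.+1 y - F i y = (F m.+1 y - F m y) + (F m y - F i y) by ring.
  rewrite (le_trans (ler_normD _ _))//.
  have h1 := FS m y; have h2 := IH im.
  have h3 : hp m * T m <= hp m * T i by rewrite ler_wpM2l ?hpge// T_le.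
  by rewrite hpS; lra.
have /choice[f fP] y : exists l, forall i, `|l - F i y| <= 2 * hp i * T i.
  apply: cvg_bound => [i m im|e e0].
    apply: le_trans (H y i m im) _; rewrite ler_wpM2r ?Tge// ler_wpM2l//.
    by rewrite gerBl hpge.
  have e2 : 0 < e / 2 by rewrite divr_gt0.
  have [N Ne] := half_expn_lt e2; exists N.
  have h := Ne _ (leqnn N); rewrite ltr_pdivlMr// mulrC in h.
  apply: le_lt_trans h; rewrite ger_pMr ?mulr_gt0//.
  by rewrite -T0 T_le.
by exists f.
Qed.

Variable f : X -> R.
Hypothesis fF : forall y i, `|f y - F i y| <= 2 * hp i * T i.

Lemma alternating_limit_bound y : `|f y| <= 2.
Proof. by have := fF y 0; rewrite F0 subr0 T0 expr0 !mulr1. Qed.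

Section AtPoint.
Variables (x : X) (c : nat -> 'rV[R]_n) (a : 'rV[R]_n) (A B M : R).
Hypotheses (c0 : c 0%N = 0) (aA : `|a| <= A) (B0 : 0 <= B).
Hypothesis cS : forall j, `|c j.+1 - c j - (-1) ^+ j *: a| <= hp j.
Hypothesis lin : forall j y, mdist x y < S j.+1 ->
  `|F j.+1 y - F j.+1 x - (dot (c j.+1) (phi y) - dot (c j.+1) (phi x))| <=
    B * hp j * mdist x y.

Let ler_norm4 (u v w z : R) : `|u + v + w - z| <= `|u| + `|v| + `|w| + `|z|.
Proof.
have := ler_normB (u + v + w) z; have := ler_normD (u + v) w.
have := ler_normD u v; lra.
Qed.

Let odd_sign j : ((odd j.+1)%:R : R) = (odd j)%:R + (-1) ^+ j.
Proof.
by rewrite -[in RHS]signr_odd /=; case: (odd j) => /=; rewrite ?expr0; lra.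
Qed.

(** Adding a with alternating signs leaves a surplus of a exactly at the odd indices. Once it is
    removed, the slopes converge geometrically. *)
Let c_odd j : `|(c j.+1 - (odd j.+1)%:R *: a) - (c j - (odd j)%:R *: a)|
  <= hp j.
Proof.
rewrite (_ : _ - _ - _ = c j.+1 - c j - (-1) ^+ j *: a) ?cS//.
rewrite odd_sign scalerDl; move: ((-1) ^+ j *: a) => u.
move: ((odd j)%:R *: a) (c j.+1) (c j) => v z t.
by apply/rowP => l; rewrite !mxE; ring.
Qed.

Lemma slope_bound j : `|c j| <= A + 2.
Proof.
have := geometric_dist c_odd (leq0n j).
rewrite c0 /= scale0r !subr0 expr0 => h.
have -> : c j = (odd j)%:R *: a + (c j - (odd j)%:R *: a).
  by rewrite addrC subrK.
rewrite (le_trans (ler_normD _ _))// lerD//.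
  rewrite normrZ; apply: le_trans aA; case: (odd j); rewrite ?normr1 ?mul1r//.
  by rewrite normr0 mul0r.
by have := hp0 j; lra.
Qed.

(** [F j.+1] is nearly linear below the scale [S j.+1], and the terms after it amount to at most
    2^-j [T j.+1]. At distances between [T j.+1] and [S j.+1] the limit therefore has slope [c j.+1]
    up to O(2^-j). *)
Lemma alternating_lin j y : mdist x y < S j.+1 ->
  `|f y - f x - (dot (c j.+1) (phi y) - dot (c j.+1) (phi x))| <=
    (B + 2) * hp j * (mdist x y + T j.+1).
Proof.
move=> yS; have h1 := lin yS; have h2 := fF y j.+1; have h3 := fF x j.+1.
have d0 := mdist_ge0 x y.
have h4 : 0 <= hp j * mdist x y by rewrite mulr_ge0 ?hpge.
have h5 : 0 <= B * (hp j * T j.+1) by rewrite !mulr_ge0 ?hpge ?Tge.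
move: h1 h2 h3; rewrite hpS !ler_norml.
by move=> /andP[? ?] /andP[? ?] /andP[? ?]; apply/andP; split; lra.
Qed.

(** Let m be the first index with [S m.+1] at most [mdist x y]. At this distance [F m] is nearly
    linear with bounded slope (or zero, if m = 0), the next term is L-Lipschitz, and the tail after
    it is at most twice the distance. Linearity is known around x alone, so the bound holds for
    increments from x. *)
Lemma alternating_pointwise_lip y :
  `|f y - f x| <= (B + n%:R * k * (A + 2) + L + 2) * mdist x y.
Proof.
have A0 : 0 <= A by exact: le_trans aA.
have nk0 : 0 <= n%:R * k by rewrite mulr_ge0.
have [->|xy] := eqVneq x y; first by rewrite subrr normr0 mdistxx mulr0.
have d0 : 0 < mdist x y by rewrite mdist_gt0.
have exj : exists j, S j.+1 <= mdist x y.
  have [N Nd] := half_expn_lt d0; exists N.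
  by rewrite (le_trans (Shp N))// ltW// Nd.
have LP j : `|(F j.+1 y - F j y) - (F j.+1 x - F j x)| <= L * mdist x y.
  by have [_ /(_ y x)] := FL j; rewrite metric_sym.
have tail j : S j.+1 <= mdist x y -> `|f y - F j.+1 y| + `|f x - F j.+1 x| <=
    2 * mdist x y.
  move=> Sj; have h1 := fF y j.+1; have h2 := fF x j.+1.
  have h3 : hp j * T j.+1 <= 1 * T j.+1 by rewrite ler_wpM2r ?Tge ?hp1.
  by have := TS j; rewrite hpS in h1 h2; lra.
have p1 : 0 <= B * mdist x y by rewrite mulr_ge0// ltW.
have p2 : 0 <= n%:R * k * (A + 2) * mdist x y.
  by rewrite !mulr_ge0 ?addr_ge0// ltW.
case: (ex_minnP exj) => -[|j] Sj jmin.
  have h1 := LP 0; have h2 := tail _ Sj; rewrite !F0 !subr0 in h1.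
  have -> : f y - f x = (f y - F 1 y) - (f x - F 1 x) + (F 1 y - F 1 x) by ring.
  rewrite (le_trans (ler_normD _ _))//.
  by have := ler_normB (f y - F 1 y) (f x - F 1 x); lra.
have yS : mdist x y < S j.+1.
  by rewrite ltNge; apply/negP => /jmin; rewrite ltnn.
have h0 := lin yS; have h1 := LP j.+1; have h2 := tail _ Sj.
have h3 : B * hp j * mdist x y <= B * mdist x y.
  by rewrite -mulrA ler_wpM2l// ger_pMl ?hp1.
have h4 : `|dot (c j.+1) (phi y) - dot (c j.+1) (phi x)| <=
    n%:R * k * (A + 2) * mdist x y.
  have [_ /(_ y x)] := lip_dot k0 phik (c j.+1); rewrite metric_sym.
  move=> /le_trans; apply; rewrite ler_wpM2r ?mdist_ge0// ler_wpM2l//.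
  exact: slope_bound.
have -> : f y - f x = ((f y - F j.+2 y) - (f x - F j.+2 x)) +
  ((F j.+2 y - F j.+1 y) - (F j.+2 x - F j.+1 x)) +
  (F j.+1 y - F j.+1 x - (dot (c j.+1) (phi y) - dot (c j.+1) (phi x))) +
  (dot (c j.+1) (phi y) - dot (c j.+1) (phi x)) by ring.
move: h0 h1 h2 h4.
set u1 := f y - _ ; set u2 := f x - _; set u3 := _ - _ - (_ - _).
set u4 := _ - _ - (_ - _); set u5 := dot _ _ - _ => h0 h1 h2 h4.
have := ler_normD (u1 - u2 + u4 + u3) u5; have := ler_normD (u1 - u2 + u4) u3.
have := ler_normD (u1 - u2) u4; have := ler_normB u1 u2; lra.
Qed.

Variables (g : X -> R) (b : 'rV[R]_n).
Hypotheses (M0 : 0 < M) (gb : is_partials phi g x b).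
Hypothesis g_lin : forall j y, mdist x y < S j.+1 / 4 ->
  `|g y - g x - (dot (c j.+1) (phi y) - dot (c j.+1) (phi x))| <=
    (B + 2) * hp j * (mdist x y + T j.+1).
Hypothesis detect : forall j (q : 'rV[rat]_n), q != 0 -> (pickle q < j)%N ->
  exists y, [/\ T j.+1 < mdist x y, mdist x y < S j.+1 / 4 &
    `|ratv q : 'rV[R]_n| * mdist x y <
      M * `|dot (ratv q) (phi y) - dot (ratv q) (phi x)|].

(** Let e be the difference of the two sides. In the annuli whose slope has parity p the increments
    of e are negligible, while every rational q is eventually detected there; so |q| <= M K |q - e|.
    Letting q tend to e gives e = 0. *)
Lemma partials_limit be (p : bool) :
  (forall i, `|be - (c i - (odd i)%:R *: a)| <= 2 * hp i) ->
  b = be + p%:R *: a.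
Proof.
move=> beP; have [K KE] : exists K, n%:R * k = K by exists (n%:R * k).
have K0 : 0 <= K by rewrite -KE mulr_ge0.
have B20 : 0 <= B + 2 by rewrite addr_ge0.
pose e := b - (be + p%:R *: a).
have H q : q != 0 -> `|ratv q : 'rV[R]_n| <= M * (K * `|ratv q - e|).
  move=> q0; apply/ler_addgt0Pr => eps eps0.
  (* K accounts for the distance of the slope from its limit; 2 (B + 2) is the linearization error
     at distances above [T j.+1]. *)
  pose D := K + 2 * B + 4; have D0 : 0 < D by rewrite ltr_wpDl// addr_ge0// mulr_ge0.
  have e1 : 0 < eps / (2 * M) by rewrite divr_gt0// mulr_gt0.
  have [r r0 gr] := (is_partialsP _ _ _ _).1 gb _ e1.
  have e2 : 0 < Num.min r (eps / (2 * M) / D) by rewrite lt_min r0 divr_gt0.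
  have [N Nr] := half_expn_lt e2.
  (* Large, beyond the code of q, and even exactly when p holds, so that [odd j.+1] is p. *)
  pose j := (N + (pickle q).+1).*2 + ~~ p.
  have mj : (N + (pickle q).+1 <= j)%N.
    by rewrite /j -addnn; exact: leq_trans (leq_addr _ _) (leq_addr _ _).
  have Nj : (N <= j)%N by apply: leq_trans mj; exact: leq_addr.
  have qj : (pickle q < j)%N by apply: leq_trans mj; exact: leq_addl.
  have oj : odd j.+1 = p by rewrite /j /= oddD odd_double oddb /= negbK.
  have := Nr _ Nj; rewrite lt_min => /andP[hjr]; rewrite ltr_pdivlMr// => hjD.
  have [y [Ty yS yM]] := detect q0 qj.
  have yr : mdist x y < r.
    apply: lt_trans yS _; apply: le_lt_trans hjr; have := Shp j; have := hp0 j.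
    lra.
  have h1 := gr _ yr; have h2 := g_lin yS.
  have d0 : 0 < mdist x y by exact: lt_trans (Tgt0 _) Ty.
  have h3 : (B + 2) * hp j * (mdist x y + T j.+1) <=
      (B + 2) * hp j * (2 * mdist x y).
    apply: ler_wpM2l; first exact: mulr_ge0.
    by rewrite mulr_natl mulr2n lerD2l ltW.
  pose w := e - (b - c j.+1).
  have h4 : `|w| <= hp j.
    have := beP j.+1; rewrite oj hpS mulrCA divff// mulr1; congr (_ <= _).
    rewrite /w /e -normrN; congr `|_|; move: (_ *: a) => u.
    by apply/rowP => l; rewrite !mxE; ring.
  have [_ /(_ y x)] := lip_dot k0 phik w; rewrite metric_sym KE => h5.
  have {h4}h5 := le_trans h5 (ler_wpM2r (ltW d0) (ler_wpM2l K0 h4)).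
  have [_ /(_ y x)] := lip_dot k0 phik (ratv q - e).
  rewrite metric_sym KE => h6.
  have : dot (ratv q) (phi y) - dot (ratv q) (phi x) =
     (dot (ratv q - e) (phi y) - dot (ratv q - e) (phi x)) +
     (dot w (phi y) - dot w (phi x)) +
     (g y - g x - (dot (c j.+1) (phi y) - dot (c j.+1) (phi x))) -
     (g y - dot b (phi y) - (g x - dot b (phi x))).
    by rewrite /w !dotBl; ring.
  move: h1 h2 h5 h6; set u1 := g y - _ - _; set u2 := g y - _ - _.
  set u3 := dot w _ - _; set u4 := dot _ _ - _ => h1 h2 h5 h6 E.
  rewrite {}E in yM.
  have h7 : `|u4 + u3 + u2 - u1| <= (K * `|ratv q - e| + eps / (2 * M) +
      D * hp j) * mdist x y.
    apply: le_trans (ler_norm4 _ _ _ _) _.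
    have -> : (K * `|ratv q - e| + eps / (2 * M) + D * hp j) * mdist x y =
        K * `|ratv q - e| * mdist x y + K * hp j * mdist x y +
        (B + 2) * hp j * (2 * mdist x y) + eps / (2 * M) * mdist x y.
      by rewrite /D; ring.
    by apply: lerD h1; apply: lerD (le_trans h2 h3); exact: lerD.
  have h8 : D * hp j <= eps / (2 * M) by rewrite mulrC ltW.
  have h9 : `|u4 + u3 + u2 - u1| <= (K * `|ratv q - e| + eps / M) * mdist x y.
    apply: le_trans h7 _; apply: ler_wpM2r; first exact: ltW.
    rewrite -addrA lerD2l.
    have -> : eps / M = eps / (2 * M) + eps / (2 * M).
      by field; rewrite gt_eqF.
    by rewrite lerD2l.
  have := lt_le_trans yM (ler_wpM2l (ltW M0) h9).
  rewrite [ltRHS]mulrA ltr_pM2r// mulrDr => /ltW/le_trans; apply.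
  by rewrite lerD2l mulrC divfK// gt_eqF.
apply/eqP; rewrite -subr_eq0 -/e; apply/negP => /negP e0.
have ne : 0 < `|e| by rewrite normr_gt0.
have MK0 : 0 <= M * K by rewrite mulr_ge0// ltW.
(* An eta-close q would satisfy |e| - eta <= |q| <= M K eta, that is, |e| <= |e| / 2. *)
pose eta := `|e| / (2 * (1 + M * K)).
have eta0 : 0 < eta by rewrite divr_gt0// mulr_gt0//; lra.
have etaE : 2 * (1 + M * K) * eta = `|e|.
  by rewrite /eta mulrC divfK// gt_eqF// mulr_gt0//; lra.
have MKe : 0 <= M * K * eta by rewrite mulr_ge0// ltW.
have [q eq] := ratv_dense e eta0.
have etae : eta < `|e| by rewrite -etaE; lra.
have := H q (ratv_neq0 etae eq); rewrite distrC mulrA => h.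
have := le_trans h (ler_wpM2l MK0 eq).
have : `|e| - eta <= `|ratv q : 'rV[R]_n|.
  by rewrite lerBlDr -lerBlDl (le_trans _ eq)// lerB_dist.
rewrite -etaE; lra.
Qed.

(** The derivative of g, read off along the scales of either parity, would be both be and be + a. *)
Lemma not_differentiable : a = 0.
Proof.
have [be beP] := geometric_cvg_row c_odd.
have := partials_limit true beP; rewrite (partials_limit false beP).
by rewrite scale0r scale1r => /addrI.
Qed.

End AtPoint.
End AlternatingLimit.

(** * Uniformly small functions whose differentials do not tend to zero *)

Section Closability.
Context {R : realType} {X : completeMetricType R} {n : nat}.
Variables (phi : X -> 'rV[R]_n) (k : R).
Hypothesis k0 : 0 <= k.
Hypothesis phik : forall x y, `|phi x - phi y| <= k * mdist x y.
Variable mu : {measure set (borel X) -> \bar R}.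
Variables (K : set (borel X)) (M L : R) (alpha : X -> 'rV[R]_n).
Hypotheses (mK : measurable K) (K0 : (0 < mu K)%E) (Koo : (mu K < +oo)%E).
Hypotheses (M0 : 0 < M) (KM : forall x, K x -> coercive phi M x) (L0 : 0 <= L).
Hypothesis small : forall e, 0 < e -> exists h, [/\ lip_with L h,
  forall y, `|h y| <= e & forall x, K x -> exists c,
  is_partials phi h x c /\ `|c - alpha x| <= e].

Local Notation hp j := (2^-1 ^+ j : R).

(** A partial sum with its differential on K; [inner] and [outer] bound the annulus around points of
    [good] in which the final sum shows this differential. *)
Record stage := Stage { fn : X -> R; slope : X -> 'rV[R]_n; inner : R;
  outer : R; good : set (borel X) }.

Let admissible (a : stage) := [/\ exists l, lip_with l (fn a),
  forall x, K x -> is_partials phi (fn a) x (slope a x) & 0 < inner a].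

Let B := 1 + 2 * (n%:R * k * M).

Let refines e j (a a' : stage) := [/\
  exists h, [/\ lip_with L h, forall y, `|h y| <= hp j * inner a &
    forall y, fn a' y = fn a y + (-1) ^+ j * h y],
  forall x, K x -> `|slope a' x - slope a x - (-1) ^+ j *: alpha x| <= hp j,
  [/\ inner a' < outer a', outer a' <= inner a & outer a' <= hp j],
  measurable (good a') /\ (mu (K `\` good a') <= (e / (2 ^ j.+1)%:R)%:E)%E &
  forall x, K x -> good a' x ->
  (forall y, mdist x y < outer a' ->
    `|fn a' y - fn a' x - (dot (slope a' x) (phi y) - dot (slope a' x) (phi x))|
      <= B * hp j * mdist x y) /\
  (forall q : 'rV[rat]_n, q != 0 -> (pickle q < j)%N -> exists y,
    [/\ inner a' < mdist x y, mdist x y < outer a' / 4 &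
      `|ratv q : 'rV[R]_n| * mdist x y <
        M * `|dot (ratv q) (phi y) - dot (ratv q) (phi x)|])].

(** The order of choices matters: h is small against the previous [inner], then [outer] is a scale
    at which the new sum is linear, and last comes [inner], small enough for detection inside
    [outer / 4], the radius that survives the envelope. *)
Let refine_exists e j a : 0 < e -> admissible a ->
  exists a', admissible a' /\ refines e j a a'.
Proof.
move=> e0 [[l al] ac t0].
have hp0 : 0 < hp j by rewrite exprn_gt0.
have [|h [hL hb hc]] := small (e := Num.min (hp j) (hp j * inner a)).
  by rewrite lt_min hp0 mulr_gt0.
have /choice[c cP] x : exists c, K x ->
    is_partials phi h x c /\ `|c - alpha x| <= hp j.
  have [Kx|nKx] := pselect (K x); last by exists 0.
  have [c [hxc hca]] := hc x Kx; exists c => _; split=> //.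
  by rewrite (le_trans hca)// ge_min lexx.
pose f' y := fn a y + (-1) ^+ j * h y.
pose C' x := slope a x + (-1) ^+ j *: c x.
have lf' := lip_withD al (lip_withZ ((-1) ^+ j) hL).
have fC' x : K x -> is_partials phi f' x (C' x).
  move=> Kx; have [hcx _] := cP _ Kx.
  have := is_partials_lin 1 ((-1) ^+ j) (ac _ Kx) hcx.
  by rewrite scale1r; under eq_fun do rewrite mul1r.
have e1 : 0 < e / (2 ^ j.+1)%:R / 2.
  by rewrite !divr_gt0// ltr0n expn_gt0.
have [s1 [E1 [s10 mE1 muE1 E1P]]] :=
  uniform_linearization k0 phik mK Koo M0 KM lf' fC' hp0 e1.
pose s := Num.min s1 (Num.min (inner a) (hp j)).
have s0 : 0 < s by rewrite !lt_min s10 t0.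
have s40 : 0 < s / 4 by rewrite divr_gt0.
have [t [E2 [t'0 ts mE2 muE2 E2P]]] :=
  uniform_detection k0 phik mK Koo M0 KM j s40 e1.
exists (Stage f' C' t s (E1 `&` E2)); split; first by split=> //; eexists; exact: lf'.
split=> /=.
- exists h; split=> // y; rewrite (le_trans (hb y))// ge_min lexx orbT//.
- move=> x Kx; have [_ hca] := cP _ Kx; rewrite /C' [slope a x + _]addrC addrK.
  by rewrite -scalerBr normrZ normrX normrN1 expr1n mul1r.
- by split; [apply: lt_trans ts _; lra| |]; rewrite !ge_min lexx ?orbT.
- split; first exact: measurableI.
  rewrite setDIr; apply: le_trans (measureU2 _ _ _) _;
    [exact: measurableD|exact: measurableD|].
  by rewrite [e / _]splitr EFinD leeD.
- move=> x Kx [E1x E2x]; split=> [y ys|]; last exact: E2P.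
  by apply: E1P => //; rewrite (lt_le_trans ys)// ge_min lexx.
Qed.

(* Each h is chosen so small, compared with the scales at which the previous
   partial sum is already linear, that the partial sums bounce between two
   slopes differing by alpha at scales tending to 0. *)
Lemma nondifferentiable_sum : (forall x, K x -> alpha x != 0) ->
  exists f l (E : set (borel X)), [/\ lip_with l f, measurable E,
    E `<=` K, (0 < mu E)%E &
    forall x, E x -> ~ exists c, is_partials phi f x c].
Proof.
move=> alpha0.
have [e e0 eK] : exists2 e : R, 0 < e & (e%:E < mu K)%E.
  have fK : mu K \is a fin_num by rewrite ge0_fin_numE.
  have fK0 : 0 < fine (mu K) by rewrite fine_gt0// K0.
  exists (fine (mu K) / 2); first by rewrite divr_gt0.
  by rewrite -[ltRHS](fineK fK) lte_fin; lra.
(* The choice is made on pairs because the tolerances depend on the index of the stage. *)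
have /choice[next nextP] (ja : nat * stage) : exists a', admissible ja.2 ->
    admissible a' /\ refines e ja.1 ja.2 a'.
  have [h|h] := pselect (admissible ja.2); last by exists ja.2.
  by have [a' a'P] := refine_exists ja.1 e0 h; exists a'.
pose a0 := Stage (fun=> 0) (fun=> 0) 1 1 setT.
pose a := fix a j := if j is i.+1 then next (i, a i) else a0.
have aP j : admissible (a j).
  elim: j => [|j IH]; last by have [] := nextP (j, a j) IH.
  split=> //=; first by exists 0; exact: lip_with_cst.
  move=> x _; apply/is_partialsP => r r0; exists 1 => // y _.
  by rewrite !dot0l !subr0 normr0 mulr_ge0// ?mdist_ge0// ltW.
have aR j : refines e j (a j) (a j.+1).
  by have [] := nextP (j, a j) (aP j).
pose F j := fn (a j); pose T j := inner (a j); pose S j := outer (a j).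
have F0 y : F 0%N y = 0 by [].
have T0 : T 0%N = 1 by [].
have Tgt0 j : 0 < T j by have [] := aP j.
have TS j : T j.+1 < S j.+1 by have [_ _ []] := aR j.
have ST j : S j.+1 <= T j by have [_ _ []] := aR j.
have Shp j : S j.+1 <= hp j by have [_ _ []] := aR j.
have sgn1 j : `|(-1) ^+ j : R| = 1 by rewrite normrX normrN1 expr1n.
have FS j y : `|F j.+1 y - F j y| <= hp j * T j.
  have [[h [_ hb hE]] _ _ _ _] := aR j.
  by rewrite /F hE addrC addKr normrM sgn1 mul1r.
have FL j : lip_with L (fun y => F j.+1 y - F j y).
  have [[h [hL _ hE]] _ _ _ _] := aR j.
  have := lip_withZ ((-1) ^+ j) hL; rewrite sgn1 mul1r.
  congr (lip_with L _); apply/funext => y.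
  by rewrite /F hE [RHS]addrC addKr.
have [f fF] := alternating_limit T0 Tgt0 TS ST FS.
pose G := K `&` \bigcap_j good (a j.+1).
have mgood j : measurable (good (a j.+1)) by have [_ _ _ []] := aR j.
have mG : measurable G.
  by apply: measurableI => //; apply: bigcapT_measurable => j; exact: mgood.
have G0 : (0 < mu G)%E.
  by apply: bigcap_gt0 eK e0 _ => // j; have [_ _ _ []] := aR j.
have nk0 : 0 <= n%:R * k by rewrite mulr_ge0.
(* [alpha x] is within 1 of the differential of an L-Lipschitz function, which coercivity bounds by
   M L. *)
pose A := M * L + 1.
have A0 : 0 <= A by rewrite addr_ge0// mulr_ge0// ltW.
have B0 : 0 <= B by rewrite addr_ge0// !mulr_ge0// ltW.
(* The Lipschitz constant of f from the points of G. It also dominates the Lipschitz constants of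
   the linear approximations and their relative errors, as [envelope_approx] requires. *)
pose C' := B + n%:R * k * (A + 2) + L + 2.
have nkA : 0 <= n%:R * k * (A + 2) by rewrite mulr_ge0// addr_ge0.
have C'0 : 0 <= C' by rewrite /C' addr_ge0// addr_ge0// addr_ge0.
have [CA CB] : n%:R * k * (A + 2) <= C' /\ B + 2 <= C'.
  have gen (b u v : R) : 0 <= b -> 0 <= u -> 0 <= v ->
    u <= b + u + v + 2 /\ b + 2 <= b + u + v + 2 by move=> *; split; lra.
  exact: gen.
have C0 : 0 <= 4 * C' by rewrite mulr_ge0.
have fb := alternating_limit_bound T0 F0 fF.
exists (envelope f (4 * C')), (4 * C'), G; split=> //.
- exact: lip_envelope fb C0.
- exact: subIsetl.
move=> x [Kx Gx] [b gb]; have /negP := alpha0 x Kx; apply; apply/eqP.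
pose c j := slope (a j) x; have c0 : c 0%N = 0 by [].
have aA : `|alpha x| <= A.
  have [h [hL _ /(_ x Kx)[c' [hc' c'a]]]] := small (ltr01 : 0 < 1 :> R).
  have hc := ler_norm_partials (KM Kx) (ltW M0) hL hc'.
  have -> : alpha x = c' - (c' - alpha x) by rewrite opprB addrC subrK.
  by rewrite (le_trans (ler_normB _ _))// lerD.
have cS j : `|c j.+1 - c j - (-1) ^+ j *: alpha x| <= hp j.
  by have [_ /(_ x Kx)] := aR j.
have lin j y : mdist x y < S j.+1 ->
    `|F j.+1 y - F j.+1 x - (dot (c j.+1) (phi y) - dot (c j.+1) (phi x))| <=
    B * hp j * mdist x y.
  by have [_ _ _ _ /(_ x Kx (Gx j Logic.I))[h _]] := aR j; exact: h.
apply: (not_differentiable k0 phik Tgt0 Shp B0 cS M0 gb).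
- move=> j y yS.
  have slb := slope_bound c0 aA cS j.+1.
  have nkc : n%:R * k * `|c j.+1| <= n%:R * k * (A + 2) by rewrite ler_wpM2l.
  apply: (envelope_approx fb C0 (x := x) (s := S j.+1) (C' := C')
    (G := n%:R * k * `|c j.+1|) (g := fun y => dot (c j.+1) (phi y))) => //.
  + exact: (alternating_pointwise_lip k0 phik Tgt0 TS Shp F0 FL fF c0 aA B0 cS
      lin).
  + by have [] := lip_dot k0 phik (c j.+1).
  + by rewrite !mulr_ge0.
  + exact: le_trans nkc CA.
  + by rewrite mulr_ge0 ?exprn_ge0// addr_ge0.
  + apply: le_trans CB.
    by rewrite ger_pMr ?exprn_ile1// ?invf_le1// ?ler1n// ltr_wpDl.
  + exact: ltW.
  + move=> z zS.
    exact: (alternating_lin Tgt0 fF B0 lin zS).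
- move=> j q q0 qj.
  by have [_ _ _ _ /(_ x Kx (Gx j Logic.I))[_ h]] := aR j; exact: h.
Qed.

End Closability.

(** * Approximation by elements with convergent differentials *)

Section Minimization.
Context {d} {T : measurableType d} {R : realType} {n : nat}.
Variable mu : {measure set T -> \bar R}.
Variable K : set T.
Hypotheses (mK : measurable K) (Koo : (mu K < +oo)%E).
Implicit Types c : T -> 'rV[R]_n.

Definition bounded_measurable (A : R) c : Prop :=
  (forall i, measurable_fun K (fun x => c x ord0 i)) /\
  (forall x, K x -> `|c x| <= A).

Let nsq c x : R := dot (c x) (c x).

Let energy c : R := (\int[mu]_(x in K) nsq c x)%R.

Lemma dot_ge0 (w : 'rV[R]_n) : 0 <= dot w w.
Proof. by apply: sumr_ge0 => i _; rewrite -expr2 sqr_ge0. Qed.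

Lemma sqr_norm_le_dot (w : 'rV[R]_n) : `|w| ^+ 2 <= dot w w.
Proof.
have [->|w0] := eqVneq w 0; first by rewrite normr0 expr0n dot0l.
rewrite -[leRHS]sqr_sqrtr ?dot_ge0// lerXn2r ?nnegrE ?sqrtr_ge0//.
apply: norm_le_entry; first exact: sqrtr_ge0.
move=> i0 i; rewrite ord1 -sqrtr_sqr ler_wsqrtr// /dot (bigD1 i)//= expr2.
by rewrite lerDl; apply: sumr_ge0 => l _; rewrite -expr2 sqr_ge0.
Qed.

Lemma measurable_dot (D : set T) c c' :
  (forall i, measurable_fun D (fun x => c x ord0 i)) ->
  (forall i, measurable_fun D (fun x => c' x ord0 i)) ->
  measurable_fun D (fun x => dot (c x) (c' x)).
Proof.
move=> mc mc'; rewrite /dot; apply: measurable_sum => i.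
exact: measurable_funM.
Qed.

Let integrable_nsq A c : bounded_measurable A c ->
  mu.-integrable K (EFin \o nsq c).
Proof.
move=> [mc cA]; apply: measurable_bounded_integrable => //.
  exact: measurable_dot.
exists (n%:R * A * A); split; first exact: num_real.
move=> M AM x Kx; apply: le_trans (ltW AM).
rewrite (le_trans (ler_norm_dot _ _))// -!mulrA ler_wpM2l//.
by rewrite ler_pM// cA.
Qed.

Let energy_ge0 c : 0 <= energy c.
Proof. by apply: Rintegral_ge0 => x _; exact: dot_ge0. Qed.

Let energy_parallelogram A c c' :
  bounded_measurable A c -> bounded_measurable A c' ->
  energy (fun x => 2^-1 *: (c x + c' x)) + 4^-1 * energy (fun x => c x - c' x) =
  (energy c + energy c') / 2.
Proof.
move=> cA c'A; have [mc cb] := cA; have [mc' cb'] := c'A.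
have dA : bounded_measurable (A + A) (fun x => c x - c' x).
  split=> [i|x Kx]; last first.
    by rewrite (le_trans (ler_normB _ _))// lerD ?cb ?cb'.
  under eq_fun do rewrite !mxE; exact: measurable_funB.
have aA : bounded_measurable A (fun x => 2^-1 *: (c x + c' x)).
  split=> [i|x Kx].
    under eq_fun do rewrite !mxE; apply: measurable_funM => //.
    exact: measurable_funD.
  rewrite normrZ ger0_norm ?invr_ge0// mulrC ler_pdivrMr// mulr2n mulrDr mulr1.
  by rewrite (le_trans (ler_normD _ _))// lerD ?cb ?cb'.
have i1 := integrable_nsq cA; have i2 := integrable_nsq c'A.
have i3 := integrable_nsq dA; have i4 := integrable_nsq aA.
rewrite -RintegralZl// -RintegralD//; last exact: (integrableZl _ _ i3).
rewrite -RintegralD// mulrC -RintegralZl//; last exact: (integrableD mK i1 i2).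
apply: eq_Rintegral => x _; rewrite /nsq /dot mulr_sumr -!big_split /= mulr_sumr.
by apply: eq_bigr => i _; rewrite !mxE; lra.
Qed.

Let chebyshev A c (e : R) : bounded_measurable A c -> 0 < e ->
  (mu (K `&` [set x | (e <= nsq c x)%R]) <= (energy c / e)%:E)%E.
Proof.
move=> cA e0; have [mc _] := cA; have ic := integrable_nsq cA.
have mn : measurable_fun K (EFin \o nsq c).
  by apply/measurable_EFinP; exact: measurable_dot.
have := le_integral_abse mu mK mn e0.
have -> : (\int[mu]_(x in K) `|(EFin \o nsq c) x|)%E = (energy c)%:E.
  rewrite /energy /Rintegral fineK; last exact: integrable_fin_num.
  by apply: eq_integral => x _; rewrite /= ger0_norm// dot_ge0.
have -> : [set x | (e%:E <= `|(EFin \o nsq c) x|)%E] = [set x | e <= nsq c x].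
  by apply/seteqP; split=> x /=; rewrite lee_fin ger0_norm// dot_ge0.
by rewrite EFinM muleC -lee_pdivlMr// muleC.
Qed.

Variables (A : R) (C : nat -> set (T -> 'rV[R]_n)).
Hypotheses (C_nonempty : forall j, C j !=set0).
Hypothesis C_decr : forall i j, (i <= j)%N -> C j `<=` C i.
Hypothesis C_mid : forall j c c', C j c -> C j c' ->
  C j (fun x => 2^-1 *: (c x + c' x)).
Hypothesis CA : forall j c, C j c -> bounded_measurable A c.

Let least j := inf (energy @` C j).

Let has_lb j : has_lbound (energy @` C j).
Proof. by exists 0 => _ [c _ <-]; exact: energy_ge0. Qed.

Let least_le j c : C j c -> least j <= energy c.
Proof. by move=> Cc; apply: ge_inf => //; exists c. Qed.

Let least_bounded : exists b, forall j, least j <= b.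
Proof.
exists (n%:R * A * A * fine (mu K)) => j; have [c Cc] := C_nonempty j.
apply: le_trans (least_le Cc) _; have cA := CA Cc.
rewrite -Rintegral_cst//; apply: le_Rintegral => //.
- exact: integrable_nsq cA.
- apply: (@measurable_bounded_integrable _ _ _ mu (cst (n%:R * A * A))) => //.
  exists `|n%:R * A * A|; split; first exact: num_real.
  by move=> M AM x _; exact: ltW.
- move=> x Kx; rewrite (le_trans (ler_norm _))// (le_trans (ler_norm_dot _ _))//.
  by have [_ cb] := cA; rewrite -!mulrA ler_wpM2l// ler_pM// cb.
Qed.

Let least_mono i j : (i <= j)%N -> least i <= least j.
Proof.
move=> ij; apply: lb_le_inf.
  by have [c Cc] := C_nonempty j; exists (energy c), c.
by move=> _ [c Cc <-]; apply: least_le; exact: C_decr ij _ Cc.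
Qed.

(** The infima of the energy over the shrinking classes increase to a finite limit. For i <= j the
    midpoint of [c i] and [c j] lies in [C i], so its energy cannot be much below this limit, and
    the parallelogram identity makes the energy of the difference small. *)
Let minimizing_cauchy : exists c : nat -> T -> 'rV[R]_n,
  (forall j, C j (c j)) /\ forall e, 0 < e -> exists N, forall i j,
    (N <= i)%N -> (N <= j)%N -> energy (fun x => c i x - c j x) <= e.
Proof.
have /choice[c cP] j : exists c, C j c /\ energy c <= least j + 2^-1 ^+ j.
  have hi : has_inf (energy @` C j).
    split; last exact: has_lb.
    by have [c Cc] := C_nonempty j; exists (energy c), c.
  have hp : (0 : R) < 2^-1 ^+ j by rewrite exprn_gt0.
  by have [_ [c Cc <-] /ltW] := inf_adherent hp hi; exists c.
exists c; split=> [j|e e0]; first by have [] := cP j.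
have [b lb] := least_bounded.
have hs : has_sup (range least).
  by split; [exists (least 0), 0%N|exists b => _ [j _ <-]].
(* One e / 8 for the infima and one for near-minimality; the identity multiplies their sum by 4. *)
have e1 : 0 < e / 8 by rewrite divr_gt0.
have [_ [N1 _ <-] hN1] := sup_adherent e1 hs.
have [N2 hN2] := half_expn_lt e1.
have key i j : (maxn N1 N2 <= i)%N -> (i <= j)%N ->
    energy (fun x => c i x - c j x) <= e.
  rewrite geq_max => /andP[N1i N2i] ij.
  have [Ci ci] := cP i; have [Cj cj] := cP j.
  have := energy_parallelogram (CA Ci) (CA Cj).
  have := least_le (C_mid Ci (C_decr ij Cj)).
  have h1 := least_mono N1i; have h2 := least_mono ij.
  have h3 : least j <= sup (range least).
    by apply: sup_upper_bound => //; exists j.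
  have h4 := hN2 _ N2i; have h5 := hN2 _ (leq_trans N2i ij).
  move: hN1 ci cj h1 h2 h3 h4 h5.
  move: (energy _) (energy _) (energy _) (energy (fun=> _ - _)) => w u v z.
  move: (sup _) (2^-1 ^+ i) (2^-1 ^+ j) => *; lra.
exists (maxn N1 N2) => i j Ni Nj; have [ij|ji] := leqP i j; first exact: key.
have <- : energy (fun x => c j x - c i x) = energy (fun x => c i x - c j x).
  apply: eq_Rintegral => x _; rewrite /nsq -opprB dotNl dotC dotNl opprK.
  by [].
exact: key (ltnW ji).
Qed.

(* Mazur's lemma in L^2: nearly energy-minimizing elements of the classes C j
   form a Cauchy sequence by the parallelogram identity. *)
Lemma minimizing_sequence (e : R) : 0 < e ->
  exists (c : nat -> T -> 'rV[R]_n) (gamma : T -> 'rV[R]_n) E,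
  [/\ measurable E, (mu (K `\` E) <= e%:E)%E, forall j, C j (c j) &
     forall x, K x -> E x -> forall j, `|gamma x - c j x| <= 2 * 2^-1 ^+ j].
Proof.
move=> e0; have [c [Cc cE]] := minimizing_cauchy.
have hp0 j : (0 : R) < 2^-1 ^+ j by rewrite exprn_gt0.
have e2 j : 0 < e / (2 ^ j.+1)%:R by rewrite divr_gt0// ltr0n expn_gt0.
(* By Chebyshev, this threshold makes consecutive terms differ by at least 2^-j only on a set of
   measure at most e / 2^(j+1). *)
have /choice[N NP] j : exists N, forall i l, (N <= i)%N -> (N <= l)%N ->
    energy (fun x => c i x - c l x) <=
      e / (2 ^ j.+1)%:R * (2^-1 ^+ j) ^+ 2.
  by apply: cE; rewrite mulr_gt0// exprn_gt0.
(* The sum keeps both [nu j] and [nu j.+1] above [N j]; the summand j keeps the subsequence in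
   [C j]. *)
pose nu j := (j + \sum_(i < j.+1) N i)%N.
have nuj j : (j <= nu j)%N by exact: leq_addr.
have nuN j : (N j <= nu j)%N.
  by rewrite /nu big_ord_recr /= addnA leq_addl.
have nuS j : (N j <= nu j.+1)%N.
  rewrite /nu big_ord_recr /= addnA (leq_trans _ (leq_addr _ _))//.
  by rewrite big_ord_recr /= addnA leq_addl.
pose D j x := c (nu j) x - c (nu j.+1) x.
have DA j : bounded_measurable (A + A) (D j).
  have [m1 b1] := CA (Cc (nu j)); have [m2 b2] := CA (Cc (nu j.+1)).
  split=> [i|x Kx]; last first.
    by rewrite (le_trans (ler_normB _ _))// lerD ?b1 ?b2.
  under eq_fun do rewrite !mxE; exact: measurable_funB.
pose bad j := K `&` [set x | (2^-1 ^+ j) ^+ 2 <= nsq (D j) x].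
have mbad j : measurable (bad j).
  rewrite /bad.
  have mn : measurable_fun K (EFin \o nsq (D j)).
    by apply/measurable_EFinP; apply: measurable_dot; have [] := DA j.
  have := emeasurable_fun_c_infty mK mn ((2^-1 ^+ j) ^+ 2)%:E.
  by congr measurable; apply/seteqP; split=> x /=; rewrite lee_fin.
have mubad j : (mu (bad j) <= (e / (2 ^ j.+1)%:R)%:E)%E.
  have sq0 : (0 : R) < (2^-1 ^+ j) ^+ 2 by rewrite exprn_gt0.
  apply: le_trans (chebyshev (DA j) sq0) _; rewrite lee_fin ler_pdivrMr//.
  exact: NP.
pose E := ~` \bigcup_j bad j.
have /choice[gamma gP] x : exists g, K x -> E x ->
    forall j, `|g - c (nu j) x| <= 2 * 2^-1 ^+ j.
  have [Kx|nKx] := pselect (K x); last by exists 0.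
  have [Ex|nEx] := pselect (E x); last by exists 0.
  have step j : `|c (nu j.+1) x - c (nu j) x| <= 2^-1 ^+ j.
    rewrite distrC -(@ler_pXn2r _ 2)// ?nnegrE ?exprn_ge0//.
    apply: le_trans (sqr_norm_le_dot _) _; rewrite leNgt; apply/negP => h.
    by apply: Ex; exists j => //; split=> //=; exact: ltW.
  by have [g gP] := @geometric_cvg_row R n (fun j => c (nu j) x) step; exists g.
exists (c \o nu), gamma, E; split=> //.
- by apply: measurableC; exact: bigcupT_measurable.
- rewrite setDE setCK; apply: (@le_trans _ _ (mu (\bigcup_j bad j))).
    apply: le_measure; rewrite ?inE; last exact: subIsetr.
      by apply: measurableI => //; exact: bigcupT_measurable.
    exact: bigcupT_measurable.
  apply: (@le_trans _ _ (\sum_(0 <= j <oo) mu (bad j)))%E.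
    by apply: measure_sigma_subadditive => //; exact: bigcupT_measurable.
  apply: le_trans (epsilon_trick0 xpredT (ltW e0)).
  by apply: lee_nneseries => // j _; exact: mubad.
- by move=> j; exact: C_decr (nuj j) _ (Cc _).
Qed.

End Minimization.

(** * A differentiable substitute for the minimum *)

Section SmoothMin.
Context {R : realType}.
Implicit Types (a b e s t : R).

Definition hypot e t : R := Num.sqrt (t ^+ 2 + e ^+ 2).

(* Unlike min, differentiable at ties. *)
Definition smin e a b : R := (a + b - hypot e (a - b)) / 2.

Lemma sqr_hypot e t : hypot e t ^+ 2 = t ^+ 2 + e ^+ 2.
Proof. by rewrite sqr_sqrtr// addr_ge0 ?sqr_ge0. Qed.

Lemma hypot_ge_norm e t : `|t| <= hypot e t.
Proof.
by rewrite -sqrtr_sqr ler_wsqrtr// lerDl sqr_ge0.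
Qed.

Lemma hypot_ge e t : e <= hypot e t.
Proof.
by apply: le_trans (ler_norm e) _; rewrite -sqrtr_sqr ler_wsqrtr// lerDr sqr_ge0.
Qed.

Lemma hypot_ge0 e t : 0 <= hypot e t.
Proof. exact: sqrtr_ge0. Qed.

Lemma hypot_le e t : 0 <= e -> hypot e t <= `|t| + e.
Proof.
move=> e0; rewrite -[leRHS]ger0_norm ?addr_ge0// -sqrtr_sqr ler_wsqrtr//.
rewrite sqrrD real_normK ?num_real// -addrA lerD2l lerDr.
by rewrite mulrn_wge0// mulr_ge0.
Qed.

(** With a and b the values at s and t, a times the remainder is a b - e^2 - s t. This is
    nonnegative by Cauchy-Schwarz and at most (t - s)^2 by 2 a b <= a^2 + b^2; finally a >= e. *)
Lemma hypot_taylor e s t : 0 < e ->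
  `|hypot e t - hypot e s - s / hypot e s * (t - s)| <= (t - s) ^+ 2 / e.
Proof.
move=> e0; have := sqr_hypot e s; have := sqr_hypot e t.
have := hypot_ge e s; have := hypot_ge0 e t.
move: (hypot e s) (hypot e t) => a b b0 ea hb ha.
have a0 : 0 < a by exact: lt_le_trans ea.
have p1 : e ^+ 2 + s * t <= a * b.
  have [h|h] := leP (e ^+ 2 + s * t) 0; first by rewrite (le_trans h)// mulr_ge0// ltW.
  rewrite -(@ler_pXn2r _ 2)// ?nnegrE ?(ltW h) ?mulr_ge0 ?(ltW a0)//.
  rewrite exprMn ha hb; have := mulr_ge0 (sqr_ge0 e) (sqr_ge0 (s - t)).
  lra.
have p2 : a * b - e ^+ 2 - s * t <= (t - s) ^+ 2.
  have := sqr_ge0 (a - b); have := sqr_ge0 (t - s); lra.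
have -> : b - a - s / a * (t - s) = (a * b - e ^+ 2 - s * t) / a.
  have -> : e ^+ 2 = a ^+ 2 - s ^+ 2 by rewrite ha; ring.
  by field; rewrite gt_eqF.
rewrite ger0_norm ?divr_ge0 ?(ltW a0)//; last by lra.
rewrite ler_pdivrMr// mulrAC ler_pdivlMr//.
apply: ler_pM => //; [by lra|exact: ltW].
Qed.

Lemma smin_lel e a b : smin e a b <= a.
Proof.
rewrite /smin ler_pdivrMr//; have := hypot_ge_norm e (a - b).
by rewrite ler_norml => /andP[h1 h2]; lra.
Qed.

Lemma smin_ler e a b : smin e a b <= b.
Proof.
rewrite /smin ler_pdivrMr//; have := hypot_ge_norm e (a - b).
by rewrite ler_norml => /andP[h1 h2]; lra.
Qed.

Lemma smin_ge e a b m : 0 <= e -> m <= a -> m <= b -> m - e / 2 <= smin e a b.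
Proof.
move=> e0 ma mb; rewrite /smin ler_pdivlMr//; have := hypot_le (a - b) e0.
by case: ger0P => h1 h2; lra.
Qed.

Lemma hypot_lip e s t : `|hypot e t - hypot e s| <= `|t - s|.
Proof.
have H u w : hypot e u - hypot e w <= `|u - w|.
  rewrite lerBlDl.
  have n0 : 0 <= hypot e w + `|u - w| by rewrite addr_ge0// hypot_ge0.
  rewrite -(@ler_pXn2r _ 2)// ?nnegrE ?hypot_ge0//.
  rewrite sqrrD !sqr_hypot real_normK ?num_real//.
  have : w * (u - w) <= hypot e w * `|u - w|.
    rewrite (le_trans (ler_norm _))// normrM ler_wpM2r//.
    exact: hypot_ge_norm.
  by rewrite mulr2n => h; lra.
rewrite ler_norml; have := H t s; have := H s t; rewrite [`|s - t|]distrC.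
by move=> *; apply/andP; split; lra.
Qed.

(** The constant does not grow, so smooth minima can be iterated any number of times without losing
    the Lipschitz bound. *)
Lemma smin_lip e a b a' b' l : `|a - a'| <= l -> `|b - b'| <= l ->
  `|smin e a b - smin e a' b'| <= l.
Proof.
rewrite /smin !ler_norml => /andP[h1 h2] /andP[h3 h4].
have := hypot_lip e (a' - b') (a - b).
move: (hypot e _) (hypot e _) => u w; rewrite ler_norml => /andP[h5 h6].
have [h|h] := leP 0 (a - b - (a' - b')).
  by rewrite (ger0_norm h) in h5 h6; apply/andP; split; lra.
by rewrite (ltr0_norm h) in h5 h6; apply/andP; split; lra.
Qed.

End SmoothMin.

Section Clip.
Context {R : realType}.
Implicit Types (a u w : R).

(** Truncation to [-a, a]; it turns smallness on a compact set into smallness on all of X. *)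
Definition clip a u : R := Num.max (- a) (Num.min a u).

Lemma clip_bound a u : 0 <= a -> `|clip a u| <= a.
Proof.
move=> a0; rewrite ler_norml /clip le_max lexx /= ge_max ge_min lexx /=.
by rewrite ge0_cp.
Qed.

Lemma clip_id a u : `|u| <= a -> clip a u = u.
Proof. by rewrite ler_norml /clip => /andP[h1 h2]; rewrite min_r// max_r. Qed.

Lemma clip_lip a u w : 0 <= a -> `|clip a u - clip a w| <= `|u - w|.
Proof.
move=> a0; have H y z : clip a y - clip a z <= `|y - z|.
  have d0 := normr_ge0 (y - z); have dyz := ler_norm (y - z).
  have my : Num.min a y <= y by rewrite ge_min lexx orbT.
  have ma : Num.min a y <= a by rewrite ge_min lexx.
  have mz : Num.min a y - `|y - z| <= Num.min a z by rewrite le_min; lra.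
  have cz : Num.min a z <= clip a z by rewrite le_max lexx orbT.
  have ca : - a <= clip a z by rewrite le_max lexx.
  by rewrite lerBlDr {1}/clip ge_max; lra.
rewrite ler_norml; have := H u w; have := H w u; rewrite [`|w - u|]distrC.
by move=> *; apply/andP; split; lra.
Qed.

End Clip.

(** * McShane approximants with differentials in the span *)

Section Approximants.
Context {R : realType} {X : completeMetricType R} {n : nat}.
Variable phi : X -> 'rV[R]_n.

(** Chain rule: for l-Lipschitz f the quadratic Taylor remainder is at most l^2 d^2 / e at distance
    d, which is o(d). *)
Lemma is_partials_hypot f x c l e : 0 < e -> lip_with l f ->
  is_partials phi f x c ->
  is_partials phi (fun y => hypot e (f y)) x (f x / hypot e (f x) *: c).
Proof.
move=> e0 [l0 fl] /is_partialsP fc; apply/is_partialsP => eps eps0.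
have eps2 : 0 < eps / 2 by rewrite divr_gt0.
have [r r0 fr] := fc _ eps2.
pose D := l ^+ 2 / e + 1.
have D0 : 0 < D by rewrite ltr_pwDr// divr_ge0 ?sqr_ge0// ltW.
have s0 : 0 < Num.min r (eps / 2 / D) by rewrite lt_min r0 divr_gt0.
exists (Num.min r (eps / 2 / D)) => // y.
rewrite lt_min => /andP[yr]; rewrite ltr_pdivlMr// => yD.
have d0 := mdist_ge0 x y.
have h1 := fr _ yr; have h2 := hypot_taylor (f x) (f y) e0.
set la := f x / hypot e (f x) in h2 *.
have la1 : `|la| <= 1.
  have h0 : 0 < hypot e (f x) by exact: lt_le_trans (hypot_ge _ _).
  by rewrite normrM normfV (gtr0_norm h0) ler_pdivrMr// mul1r hypot_ge_norm.
have h3 : (f y - f x) ^+ 2 / e <= eps / 2 * mdist x y.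
  have h4 : (f y - f x) ^+ 2 <= l ^+ 2 * mdist x y * mdist x y.
    rewrite -real_normK ?num_real// -mulrA -expr2 -exprMn.
    rewrite ler_pXn2r// ?nnegrE ?mulr_ge0//.
    by have := fl y x; rewrite metric_sym.
  apply: (@le_trans _ _ (l ^+ 2 * mdist x y * mdist x y / e)).
    by rewrite ler_wpM2r// invr_ge0 ltW.
  rewrite mulrAC ler_wpM2r//; apply: le_trans (ltW yD).
  by rewrite mulrAC mulrC ler_wpM2l// lerDl.
have h4 : `|la * (f y - dot c (phi y) - (f x - dot c (phi x)))| <=
    eps / 2 * mdist x y.
  by rewrite normrM (le_trans _ h1)// ler_piMl.
rewrite !dotZl [eps]splitr mulrDl.
have -> : hypot e (f y) - la * dot c (phi y) -
    (hypot e (f x) - la * dot c (phi x)) =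
    (hypot e (f y) - hypot e (f x) - la * (f y - f x)) +
    la * (f y - dot c (phi y) - (f x - dot c (phi x))) by ring.
by rewrite (le_trans (ler_normD _ _))// lerD// (le_trans h2).
Qed.

Lemma is_partials_smin f g x c c' l e : 0 < e ->
  lip_with l f -> lip_with l g ->
  is_partials phi f x c -> is_partials phi g x c' ->
  exists a b, is_partials phi (fun y => smin e (f y) (g y)) x (a *: c + b *: c').
Proof.
move=> e0 fl gl fc gc.
have wc := is_partials_lin 1 (-1) fc gc.
have wl : lip_with (l + l) (fun y => 1 * f y + -1 * g y).
  have := lip_withB fl gl; congr (lip_with _ _).
  by apply/funext => y; rewrite mul1r mulN1r.
have hc := is_partials_hypot e0 wl wc.
have pc := is_partials_lin 2^-1 2^-1 fc gc.
have := is_partials_lin 1 (- 2^-1) pc hc.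
set la := _ / hypot _ _; rewrite scale1r => sc.
exists (2^-1 - 2^-1 * la), (2^-1 + 2^-1 * la); move: sc.
have -> : 2^-1 *: c + 2^-1 *: c' + - 2^-1 *: (la *: (1 *: c + -1 *: c')) =
    (2^-1 - 2^-1 * la) *: c + (2^-1 + 2^-1 * la) *: c'.
  by apply/rowP => i; rewrite !mxE; ring.
congr (is_partials phi _ x _); apply/funext => y.
by rewrite /smin !mul1r mulN1r; field.
Qed.

Variables (rho : X -> X -> R) (v : X -> R) (L Lam : R).
Hypotheses (L0 : 0 <= L) (Lam0 : 0 <= Lam).
Hypothesis rho_lip : forall y, lip_with Lam (rho^~ y).
Hypothesis rho_le : forall x y, rho x y <= Lam * mdist x y.
Hypothesis v_rho : forall x y, `|v x - v y| <= L * rho x y.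
Variables (K : set X) (W : X -> 'M[R]_n).

Lemma mcshane_approx (s : seq X) y0 theta : 0 < theta ->
  (forall x y, K x -> y \in y0 :: s -> exists c,
    is_partials phi (rho^~ y) x c /\ (c <= W x)%MS) ->
  exists g, [/\ lip_with (L * Lam) g, forall x, v x - theta <= g x,
    forall x y, y \in y0 :: s -> g x <= v y + L * rho x y &
    forall x, K x -> exists c, is_partials phi g x c /\ (c <= W x)%MS].
Proof.
have cone_lip y : lip_with (L * Lam) (fun x => v y + L * rho x y).
  have := lip_withD (lip_with_cst (v y)) (lip_withZ L (rho_lip y)).
  by rewrite add0r ger0_norm.
have cone_ge x y : v x <= v y + L * rho x y.
  by have := v_rho x y; rewrite ler_norml => /andP[h1 h2]; lra.
have cone_diff x y : (exists c, is_partials phi (rho^~ y) x c /\ (c <= W x)%MS) ->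
    exists c, is_partials phi (fun x => v y + L * rho x y) x c /\ (c <= W x)%MS.
  move=> [c [yc cW]]; exists (L *: c); split; last exact: scalemx_sub.
  apply/is_partialsP; move/is_partialsP: yc => /(flatZ L) => h e e0.
  have [r r0 hr] := h e e0; exists r => // z /hr; rewrite !dotZl.
  by congr (`|_| <= _); ring.
elim: s theta => [|y s IH] theta th0 diff.
  exists (fun x => v y0 + L * rho x y0); split=> // [x|x y|x Kx].
  - by have := cone_ge x y0; lra.
  - by rewrite inE => /eqP ->.
  - by apply: cone_diff; apply: diff => //; rewrite mem_head.
have [|x z Kx zs|g [gl vg gle gdiff]] := IH (theta / 2).
- by rewrite divr_gt0.
- by apply: diff => //; move: zs; rewrite !inE => /orP[->//|->]; rewrite !orbT.
(* [smin theta] falls at most theta / 2 below the minimum, and g has used the other half of the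
   tolerance. *)
exists (fun x => smin theta (g x) (v y + L * rho x y)); split.
- split=> [|x z]; first by rewrite mulr_ge0.
  by apply: smin_lip; [have [_] := gl|have [_] := cone_lip y]; exact.
- move=> x; have := @smin_ge R theta (g x) (v y + L * rho x y)
    (v x - theta / 2) (ltW th0) (vg x).
  by have := cone_ge x y => ? /(_ _); lra.
- move=> x z; rewrite inE => /predU1P[->|].
    by rewrite (le_trans (smin_lel _ _ _))// gle// mem_head.
  rewrite inE => /predU1P[->|zs]; first exact: smin_ler.
  by rewrite (le_trans (smin_lel _ _ _))// gle// inE zs orbT.
- move=> x Kx; have [c [gc cW]] := gdiff x Kx.
  have [|c' [yc' c'W]] := cone_diff x y.
    by apply: diff => //; rewrite !inE eqxx orbT.
  have [a [b abP]] := is_partials_smin th0 gl (cone_lip y) gc yc'.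
  by exists (a *: c + b *: c'); split=> //; rewrite addmx_sub// scalemx_sub.
Qed.

Lemma open_metric_ball (x : X) r : open (ball x r).
Proof.
have := open_lip_gt0 (lip_withD (lip_withN (lip_mdist x)) (lip_with_cst r)).
congr open; apply/seteqP; rewrite ballEmdist.
by split=> y /=; rewrite metric_sym => h; lra.
Qed.

Lemma compact_net (D : set X) r : compact K -> dense D -> 0 < r ->
  exists s : seq X, (forall y, y \in s -> D y) /\
    forall x, K x -> exists2 y, y \in s & mdist x y < r.
Proof.
move=> cK dD r0; move: cK; rewrite compact_cover => cK.
have [|x Kx|s sD sK] := cK X D (fun y => ball y r).
- by move=> y _; exact: open_metric_ball.
- have [y [xy Dy]] := dD _ (ex_intro _ x (ballxx x r0)) (open_metric_ball x r).
  by exists y => //; exact: ball_sym.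
exists (finmap.enum_fset s); split=> [y ys|x /sK[y /= ys yx]].
  by have := sD _ ys; rewrite inE.
exists y => //; move: yx; rewrite ballEmdist /=.
by rewrite metric_sym.
Qed.

Lemma approximant (D : set X) theta : compact K -> dense D -> 0 < theta ->
  (exists x, K x) ->
  (forall x y, K x -> D y -> exists c,
    is_partials phi (rho^~ y) x c /\ (c <= W x)%MS) ->
  exists g, [/\ lip_with (L * Lam) g, forall x, K x -> `|g x - v x| <= theta &
    forall x, K x -> exists c, is_partials phi g x c /\ (c <= W x)%MS].
Proof.
move=> cK dD th0 [x0 Kx0] diff.
have LL0 : 0 <= L * Lam by rewrite mulr_ge0.
(* Going from x to the net point y and back costs 2 L [rho x y]; the 1 avoids division by 0. *)
have r0 : 0 < theta / (2 * (L * Lam) + 1).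
  by rewrite divr_gt0// ltr_pwDr// mulr_ge0.
have [s [sD sK]] := compact_net cK dD r0.
have [y0 y0s _] := sK x0 Kx0.
have [x y Kx ys|g [gl vg gle gdiff]] := @mcshane_approx s y0 theta th0.
  move: ys; rewrite inE => /predU1P[->|/sD]; last exact: diff.
  exact: diff (sD _ y0s).
exists g; split=> // x Kx; have [y ys xy] := sK x Kx.
have := vg x; have := gle x y _; rewrite inE ys orbT => /(_ isT) h1 h2.
have := v_rho x y; rewrite !ler_norml => /andP[h3 h4].
move: xy; rewrite ltr_pdivlMr ?ltr_pwDr// ?mulr_ge0// => xy.
have h5 := ler_wpM2l L0 (rho_le x y); have h6 := mdist_ge0 x y.
by apply/andP; split; lra.
Qed.

End Approximants.

(** The row space is the kernel of multiplication by the cokernel matrix, a continuous map, hence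
    closed. *)
Lemma submx_closed {R : realType} m n (v : 'rV[R]_n) (W : 'M[R]_(m, n)) :
  (forall e, 0 < e -> exists w : 'rV[R]_n, (w <= W)%MS /\ `|v - w| <= e) ->
  (v <= W)%MS.
Proof.
move=> vW; rewrite submxE; set N := cokermx W.
apply/eqP/rowP => j; rewrite [RHS]mxE; apply/eqP; rewrite -normr_le0.
pose b := \sum_l `|N l j|; have b0 : 0 <= b by apply: sumr_ge0.
apply/ler_addgt0Pr => e e0; rewrite add0r.
have eb : 0 < e / (b + 1) by rewrite divr_gt0// ltr_pwDr.
have [w [wW vw]] := vW _ eb.
have -> : (v *m N) ord0 j = ((v - w) *m N) ord0 j.
  move: wW; rewrite submxE => /eqP; rewrite -/N => wN.
  by rewrite mulmxBl wN subr0.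
rewrite mxE (le_trans (ler_norm_sum _ _ _))//.
apply: (@le_trans _ _ (\sum_l e / (b + 1) * `|N l j|)).
  apply: ler_sum => l _; rewrite normrM ler_wpM2r//.
  exact: le_trans (ler_entry_norm _ _ _) vw.
rewrite -mulr_sumr -/b mulrAC ler_pdivrMr ?ltr_pwDr//.
by rewrite ler_wpM2l ?(ltW e0)// lerDl.
Qed.

(** * The differential cannot leave the span on a whole compact set *)

Section CompactContradiction.
Context {R : realType} {X : completeMetricType R} {n : nat}.
Variables (phi : X -> 'rV[R]_n) (k : R).
Hypothesis k0 : 0 <= k.
Hypothesis phik : forall x y, `|phi x - phi y| <= k * mdist x y.
Variable mu : {measure set (borel X) -> \bar R}.
Variables (K : set X) (M : R).
Hypotheses (cK : compact K) (mK : measurable (K : set (borel X))).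
Hypotheses (K0 : (0 < mu K)%E) (Koo : (mu K < +oo)%E).
Hypotheses (M0 : 0 < M) (KM : forall x, K x -> coercive phi M x).
Hypothesis lip_diff : forall f l, lip_with l f ->
  mu.-negligible [set x : borel X | K x /\ ~ exists c, is_partials phi f x c].
Variables (rho : X -> X -> R) (v : X -> R) (L Lam : R).
Hypotheses (L0 : 0 <= L) (Lam0 : 0 <= Lam).
Hypothesis rho_lip : forall y, lip_with Lam (rho^~ y).
Hypothesis rho_le : forall x y, rho x y <= Lam * mdist x y.
Hypothesis v_rho : forall x y, `|v x - v y| <= L * rho x y.
Variables (W : X -> 'M[R]_n) (D : set X).
Hypothesis dD : dense D.
Hypothesis rho_diff : forall x y, K x -> D y -> exists c,
  is_partials phi (rho^~ y) x c /\ (c <= W x)%MS.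

(** It suffices to refute that dv lies outside the span at every point of K, because K will be taken
    inside the exceptional set. The limit gamma of the differentials of the approximants stays in
    the span, so alpha = dv - gamma vanishes nowhere and contradicts closability. *)
Lemma differential_mem : ~ forall x, K x -> exists c,
  is_partials phi v x c /\ ~~ (c <= W x)%MS.
Proof.
move=> /= vW; set l := L * Lam; have l0 : 0 <= l by rewrite mulr_ge0.
have vl : lip_with l v.
  split=> // x y; rewrite (le_trans (v_rho x y))// /l -mulrA ler_wpM2l//.
have /choice[cv cvP] x : exists c, K x ->
    is_partials phi v x c /\ ~~ (c <= W x)%MS.
  by have [/vW[c cP]|nKx] := pselect (K x); [exists c|exists 0].
(* Every condition survives midpoints, as the minimization requires; the common Lipschitz constant l
   bounds all differentials by M l. *)
pose C j (c : borel X -> 'rV[R]_n) := [/\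
  forall i, measurable_fun (K : set (borel X)) (fun x => c x ord0 i),
  (forall x, K x -> (c x <= W x)%MS) & exists g, [/\ lip_with l g,
    forall x, K x -> `|g x - v x| <= 2^-1 ^+ j &
    forall x, K x -> is_partials phi g x (c x)]].
have hp0 j : (0 : R) < 2^-1 ^+ j by rewrite exprn_gt0.
have exK : exists x, K x.
  by apply/set0P; apply: contraTneq K0 => ->; rewrite measure0 ltxx.
have C_nonempty j : C j !=set0.
  have [g [gl gv gW]] := approximant L0 Lam0 rho_lip rho_le v_rho cK dD (hp0 j)
    exK rho_diff.
  have gK x : K x -> exists c, is_partials phi g x c.
    by move=> /gW[c []]; exists c.
  exists (fun x => partials phi g x); split.
  - apply: (measurable_partials k0 phik mK gl _ gK) => x Kx.
    have [N _ MN] : \forall N \near \oo, M <= N%:R by exact: nbhs_infty_ger.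
    exists N => c r c0 r0; have [y yr yM] := KM Kx c0 r0.
    exists y => //; apply: lt_le_trans yM _; rewrite ler_wpM2r//.
    exact: MN N.+1 (leqnSn N).
  - move=> x Kx; have [c [gc cW]] := gW x Kx.
    by rewrite (is_partials_uniq (KM Kx) (ltW M0) (partialsP (gK x Kx)) gc).
  - by exists g; split=> // x Kx; exact/partialsP/gK.
have C_decr i j : (i <= j)%N -> C j `<=` C i.
  move=> ij c [mc cW [g [gl gv gc]]]; split=> //; exists g; split=> // x Kx.
  rewrite (le_trans (gv x Kx))// ler_wiXn2l// ?invr_ge0//.
  by rewrite invf_le1// ler1n.
have C_mid j c c' : C j c -> C j c' -> C j (fun x => 2^-1 *: (c x + c' x)).
  move=> [mc cW [g [gl gv gc]]] [mc' c'W [g' [gl' gv' gc']]]; split.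
  - move=> i; under eq_fun do rewrite !mxE.
    by apply: measurable_funM => //; exact: measurable_funD.
  - by move=> x Kx; rewrite scalemx_sub// addmx_sub ?cW ?c'W.
  - exists (fun x => 2^-1 * g x + 2^-1 * g' x); split.
    + have h := lip_withD (lip_withZ 2^-1 gl) (lip_withZ 2^-1 gl').
      apply: lip_with_le h; rewrite ger0_norm ?invr_ge0//; lra.
    + move=> x Kx; have := gv x Kx; have := gv' x Kx.
      rewrite !ler_norml => /andP[? ?] /andP[? ?].
      by apply/andP; split; lra.
    + move=> x Kx; rewrite scalerDr.
      by apply: is_partials_lin; [exact: gc|exact: gc'].
have CA j c : C j c -> bounded_measurable (K : set (borel X)) (M * l) c.
  move=> [mc _ [g [gl _ gc]]]; split=> // x Kx.
  exact: ler_norm_partials (KM Kx) (ltW M0) gl (gc x Kx).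
have fK : mu K \is a fin_num by rewrite ge0_fin_numE.
have fK0 : 0 < fine (mu K) by rewrite fine_gt0// K0.
have e0 : 0 < fine (mu K) / 2 by rewrite divr_gt0.
have [c [gamma [E [mE muE Cc gP]]]] :=
  minimizing_sequence mK Koo C_nonempty C_decr C_mid CA e0.
have mKE : measurable (K `&` E : set (borel X)) by exact: measurableI.
have KE0 : (0 < mu (K `&` E))%E.
  rewrite lt_neqAle measure_ge0 andbT eq_sym; apply/negP => /eqP KE.
  have : mu K = (mu (K `\` E) + mu (K `&` E))%E by exact: measureDI.
  rewrite KE adde0 => h; move: muE; rewrite -h -(fineK fK) lee_fin; lra.
pose alpha x := cv x - gamma x.
have [|||||f [l' [E' [fl' mE' E'K E'0 nE']]]] := nondifferentiable_sum k0 phik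
  (mu := mu) (M := M) (L := l + l) (alpha := alpha) mKE KE0 _ M0.
- exact: le_lt_trans (measureIl _ mK mE) Koo.
- by move=> x [Kx _]; exact: KM.
- exact: addr_ge0.
- move=> e e0'; have e3 : 0 < e / 3 by rewrite divr_gt0.
  have [N Ne] := half_expn_lt e3; have {Ne}hN := Ne _ (leqnn N).
  have [_ _ [g [gl gv gc]]] := Cc N.
  have ul := lip_withB vl gl.
  (* On K the difference is below e / 3, so near each point of K it stays below e and clipping does
     not alter its differential there. *)
  exists (fun y => clip e (v y - g y)); split.
  + split=> [|x y]; first by rewrite addr_ge0.
    by rewrite (le_trans (clip_lip _ _ (ltW e0')))//; have [_] := ul.
  + by move=> y; apply: clip_bound; exact: ltW.
  + move=> x [Kx Ex]; have [vx _] := cvP x Kx.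
    exists (cv x - c N x); split; last first.
      rewrite /alpha opprB addrC addrA subrK (le_trans (gP x Kx Ex N))//; lra.
    have := is_partials_lin 1 (-1) vx (gc x Kx).
    rewrite scale1r scaleN1r => vgx.
    have r0 : 0 < e / 3 / (l + l + 1).
      by rewrite divr_gt0// ltr_pwDr// addr_ge0.
    apply: (is_partials_near r0 _ vgx) => y.
    rewrite ltr_pdivlMr ?ltr_pwDr ?addr_ge0// mul1r mulN1r => xy.
    have [_ /(_ y x)] := ul; rewrite [mdist y x]metric_sym => h1.
    rewrite clip_id//; move: h1 (gv x Kx); rewrite !ler_norml.
    have d0 := mdist_ge0 x y.
    by move=> /andP[h1 h2] /andP[h3 h4]; apply/andP; split; lra.
(* If dv = gamma at x, then dv is a limit of elements of the closed span, hence in it. *)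
- move=> x [Kx Ex]; apply: contraT; rewrite negbK subr_eq0 => /eqP cg.
  have [_ /negP] := cvP x Kx; case; apply: submx_closed => e e0'.
  have e2 : 0 < e / 2 by rewrite divr_gt0.
  have [N Ne] := half_expn_lt e2; have {Ne}hN := Ne _ (leqnn N).
  exists (c N x); split; first by have [_ /(_ x Kx)] := Cc N.
  by rewrite cg (le_trans (gP x Kx Ex N))//; lra.
have [N [mN N0 EN]] := lip_diff fl'.
move: E'0; rewrite (_ : mu E' = 0%E) ?ltxx//.
apply: (subset_measure0 mE' mN) => // x E'x; apply: EN; split; last exact: nE'.
by have [] := E'K x E'x.
Qed.

End CompactContradiction.

(** * Spans and subbundles *)

Section Spans.
Context {R : realType}.

Lemma submx_sumv m n (B : 'M[R]_(m, n)) (v : 'rV[R]_n) :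
  (v \in \sum_i <[row i B]>)%VS = (v <= B)%MS.
Proof.
apply/memv_sumP/idP => [[u uB ->]|/submxP[D ->]].
  apply: summx_sub => i _; have /vlineP[a ->] := uB i isT.
  by rewrite scalemx_sub// row_sub.
exists (fun i => D ord0 i *: row i B) => [i _|].
  by rewrite memvZ// memv_line.
by rewrite mulmx_sum_row.
Qed.

Lemma sub_lin_span (V : vectType R) (S : set V) : S `<=` lin_span S.
Proof.
move=> v Sv; exists [:: v]; last by rewrite memv_span// mem_head.
by move=> w /=; rewrite inE => /eqP ->.
Qed.

Lemma lin_span_subv (V : vectType R) (S : set V) (U : {vspace V}) :
  (forall s, S s -> s \in U) -> forall v, lin_span S v -> v \in U.
Proof.
move=> SU v [l lS]; apply/subvP; apply/span_subvP => w wl.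
by apply: SU; exact: lS.
Qed.

Lemma lin_span_trans (V : vectType R) (S S' : set V) :
  S `<=` lin_span S' -> lin_span S `<=` lin_span S'.
Proof.
move=> SS' v [l lS vl].
suff [l' [l'S' ll']] : exists l', [set` l'] `<=` S' /\ (span l <= span l')%VS.
  by exists l' => //; exact: subvP ll' v vl.
elim: l lS {vl} => [|w l IH] lS.
  by exists [::]; split=> //; rewrite span_nil sub0v.
have [|l1 [l1S ll1]] := IH.
  by move=> u ul; apply: lS; rewrite /= inE (_ : u \in l) ?orbT.
have [|l2 l2S wl2] := SS' w; first by apply: lS; rewrite /= mem_head.
exists (l2 ++ l1); split.
  by move=> u /=; rewrite mem_cat => /orP[]; [exact: l2S|exact: l1S].
rewrite span_cons span_cat subv_add (subv_trans ll1) ?addvSr// andbT.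
by rewrite (subv_trans _ (addvSl _ _)).
Qed.

Lemma lin_spanS (V : vectType R) (S S' : set V) :
  S `<=` S' -> lin_span S `<=` lin_span S'.
Proof. by move=> SS' v [l lS vl]; exists l => // w /lS /SS'. Qed.

(** The rank of the first N rows is at most n; once it is maximal, no further row enlarges the
    span. *)
Lemma finite_generators n (c : nat -> 'rV[R]_n) :
  exists N, forall k, (c k <= \matrix_(i < N) c i)%MS.
Proof.
pose B N := \matrix_(i < N) c i.
have cB N k : (k < N)%N -> (c k <= B N)%MS.
  by move=> kN; have := row_sub (Ordinal kN) (B N); rewrite rowK.
have BB N N' : (N <= N')%N -> (B N <= B N')%MS.
  move=> NN'; apply/row_subP => i; rewrite rowK cB//.
  exact: leq_trans NN'.
pose P r := `[< exists N, \rank (B N) = r >].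
have exP : exists r, P r by exists (\rank (B 0%N)); apply/asboolP; exists 0%N.
have Pn r : P r -> (r <= n)%N by move=> /asboolP[N <-]; exact: rank_leq_col.
case: (ex_maxnP exP Pn) => r /asboolP[N Nr] rmax; exists N => k.
have NM : (B N <= B (maxn N k.+1))%MS by rewrite BB// leq_maxl.
apply: submx_trans (cB _ _ (leq_maxr N k.+1)) _.
have [_ <-] := mxrank_leqif_sup NM.
rewrite eqn_leq mxrankS//= Nr; apply: rmax; apply/asboolP.
by exists (maxn N k.+1).
Qed.

(** Finitely many of the [c k] already generate all of them, and minimality puts A inside their
    span. *)
Lemma lin_span_submx n (c : nat -> 'rV[R]_n) m (A : 'M[R]_(m, n)) :
  (forall k, (c k <= A)%MS) ->
  (forall p (B : 'M[R]_(p, n)), (forall k, (c k <= B)%MS) -> (A <= B)%MS) ->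
  forall v : 'rV[R]_n, lin_span (range c) v <-> (v <= A)%MS.
Proof.
move=> cA minA v; split.
  move=> /lin_span_subv; rewrite -submx_sumv; apply=> _ [k _ <-].
  by rewrite submx_sumv.
have [N cN] := finite_generators c.
move=> /submx_trans/(_ (minA _ _ cN)); rewrite -submx_sumv => vN.
exists [seq c i | i <- iota 0 N].
  by move=> _ /= /mapP[i _ ->]; exists i.
apply: subvP vN; apply/subv_sumP => i _; rewrite rowK -memvE memv_span//.
by apply/mapP; exists (i : nat) => //; rewrite mem_iota add0n /=.
Qed.

End Spans.

(** * A measurable choice of spanning rows *)

Section Gram.
Context {R : realType} {n : nat}.
Implicit Types (c : nat -> 'rV[R]_n) (u : 'rV[R]_n).

(* The factor exp(- |w|^2) bounds the entries of the weighted w^T w by 2^-k. *)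
Definition gram_weight (k : nat) (w : 'rV[R]_n) : R :=
  2^-1 ^+ k * expR (- dot w w).

Definition gram_partial c m : 'M[R]_n :=
  \sum_(k < m) gram_weight k (c k) *: ((c k)^T *m c k).

(* Its kernel is the common kernel of the c k, so its n rows span what they do;
   unlike a basis extracted from the c k, they depend measurably on them. *)
Definition gram c : 'M[R]_n :=
  \matrix_(i, j) lim (gram_partial c m i j @[m --> \oo]).

Lemma gram_weight_gt0 k w : 0 < gram_weight k w.
Proof.
by rewrite mulr_gt0 ?exprn_gt0// expR_gt0.
Qed.

Lemma gram_partial_cvg c i j m :
  `|gram c i j - gram_partial c m i j| <= 2 * 2^-1 ^+ m.
Proof.
have step q : `|gram_partial c q.+1 i j - gram_partial c q i j| <= 2^-1 ^+ q.
  rewrite /gram_partial big_ord_recr /= mxE [X in X - _]addrC addrK !mxE.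
  rewrite big_ord1 !mxE.
  have := sqr_norm_le_dot (c q); set w := c q.
  have := ler_entry_norm w ord0 i; have := ler_entry_norm w ord0 j.
  move=> wj wi ww; rewrite normrM (gtr0_norm (gram_weight_gt0 _ _)).
  rewrite /gram_weight expRN mulrAC ler_pdivrMr ?expR_gt0//.
  rewrite ler_wpM2l ?exprn_ge0// normrM.
  apply: (@le_trans _ _ (`|w| * `|w|)); first exact: ler_pM.
  rewrite -expr2 (le_trans ww)// (le_trans _ (expR_ge1Dx _))//.
  by rewrite lerDr.
have [|e e0|l lP] := @cvg_bound R (fun m => gram_partial c m i j)
    (fun m => 2 * 2^-1 ^+ m).
- move=> p q pq; apply: le_trans (@geometric_dist R R^o _ step _ _ pq) _.
  by rewrite ler_wpM2l// gerBl exprn_ge0.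
- have e2 : 0 < e / 2 by rewrite divr_gt0.
  have [N Ne] := half_expn_lt e2; exists N.
  by have := Ne _ (leqnn N); rewrite ltr_pdivlMr// mulrC.
suff -> : gram c i j = l by [].
rewrite mxE; apply: cvg_lim => //; apply/cvgrPdist_le => e e0.
have e2 : 0 < e / 2 by rewrite divr_gt0.
have [N Ne] := half_expn_lt e2; exists N => // q /= /Ne.
by rewrite ltr_pdivlMr// mulrC => /ltW; apply: le_trans.
Qed.

Lemma gram_norm c m : `|gram c - gram_partial c m| <= 2 * 2^-1 ^+ m.
Proof.
apply: norm_le_entry; first by rewrite mulr_ge0// exprn_ge0.
by move=> i j; rewrite !mxE; have := gram_partial_cvg c i j m; rewrite mxE.
Qed.

(** The rows of the partial sums lie in the row space of B, which is closed. *)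
Lemma gram_min c p (B : 'M[R]_(p, n)) : (forall k, (c k <= B)%MS) ->
  (gram c <= B)%MS.
Proof.
move=> cB; apply/row_subP => i; apply: submx_closed => e e0.
have e2 : 0 < e / 2 by rewrite divr_gt0.
have [N Ne] := half_expn_lt e2; exists (row i (gram_partial c N)); split.
  apply: submx_trans (row_sub _ _) _; apply: summx_sub => k _.
  by rewrite scalemx_sub// (submx_trans (submxMl _ _)).
apply: norm_le_entry (ltW e0) _ => i0 j; rewrite !mxE.
have := gram_partial_cvg c i j N; rewrite mxE => /le_trans; apply.
by have := Ne _ (leqnn N); rewrite ltr_pdivlMr// mulrC => /ltW.
Qed.

Lemma norm_mulmx_row u (B : 'M[R]_n) : `|u *m B| <= n%:R * `|u| * `|B|.
Proof.
apply: norm_le_entry => [|i0 j]; first by rewrite !mulr_ge0.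
rewrite ord1 mxE; apply: (@le_trans _ _ `|dot u (\row_l B l j)|).
  by rewrite le_eqVlt; apply/orP; left; apply/eqP; congr `|_|;
     apply: eq_bigr => l _; rewrite !mxE.
apply: le_trans (ler_norm_dot _ _) _; rewrite ler_wpM2l ?mulr_ge0//.
by apply: norm_le_entry => // a b; rewrite mxE ler_entry_norm.
Qed.

Lemma gram_partial_quadratic c u m : dot (u *m gram_partial c m) u =
  \sum_(j < m) gram_weight j (c j) * dot (c j) u ^+ 2.
Proof.
transitivity ((u *m gram_partial c m *m u^T) ord0 ord0).
  by rewrite [RHS]mxE; apply: eq_bigr => l _; rewrite !mxE.
rewrite /gram_partial mulmx_sumr mulmx_suml summxE; apply: eq_bigr => j _.
rewrite -scalemxAr -scalemxAl mxE; congr (_ * _).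
have E : u *m (c j)^T = (dot (c j) u)%:M.
  apply/matrixP => a b; rewrite !ord1 !mxE eqxx mulr1n.
  by apply: eq_bigr => l _; rewrite !mxE mulrC.
have E' : c j *m u^T = (dot (c j) u)%:M.
  apply/matrixP => a b; rewrite !ord1 !mxE eqxx mulr1n.
  by apply: eq_bigr => l _; rewrite !mxE.
by rewrite mulmxA E -mulmxA E' -scalar_mxM mxE eqxx mulr1n expr2.
Qed.

(** The quadratic form of [gram c] is a series of nonnegative terms, one of them a positive multiple
    of the square of [dot (c k) u]. *)
Lemma gram_ker c u k : gram c *m u^T = 0 -> dot (c k) u = 0.
Proof.
move=> Au; apply/eqP; apply/negPn/negP => cu.
pose t := gram_weight k (c k) * dot (c k) u ^+ 2.
have t0 : 0 < t by rewrite mulr_gt0 ?gram_weight_gt0// exprn_even_gt0.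
pose b := n%:R * (n%:R * `|u|) * `|u|; have b0 : 0 <= b by rewrite !mulr_ge0.
have tb : 0 < t / (2 * (b + 1)) by rewrite divr_gt0// mulr_gt0// ltr_pwDr.
have [N Ne] := half_expn_lt tb.
set m := maxn N k.+1; have := Ne m (leq_maxl _ _).
rewrite ltr_pdivlMr ?mulr_gt0 ?ltr_pwDr// => hm.
have : t <= dot (u *m gram_partial c m) u.
  rewrite gram_partial_quadratic (bigD1 (Ordinal (leq_maxr N k.+1)))//= lerDl.
  by apply: sumr_ge0 => j _; rewrite mulr_ge0 ?sqr_ge0// ltW// gram_weight_gt0.
have -> : dot (u *m gram_partial c m) u = - dot (u *m (gram c - gram_partial c m)) u.
  rewrite mulmxBr dotBl (_ : dot (u *m gram c) u = 0) ?sub0r ?opprK//.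
  transitivity ((u *m gram c *m u^T) ord0 ord0).
    by rewrite [RHS]mxE; apply: eq_bigr => l _; rewrite !mxE.
  by rewrite -mulmxA Au mulmx0 mxE.
apply/negP; rewrite -ltNge; apply: le_lt_trans (ler_norm _) _; rewrite normrN.
apply: le_lt_trans (ler_norm_dot _ _) _.
have h : n%:R * `|u *m (gram c - gram_partial c m)| * `|u| <= b * (2 * 2^-1 ^+ m).
  rewrite /b [X in _ <= X]mulrAC ler_wpM2r// -mulrA ler_wpM2l//.
  apply: le_trans (norm_mulmx_row _ _) _; rewrite ler_wpM2l ?mulr_ge0//.
  exact: gram_norm.
apply: le_lt_trans h _; apply: le_lt_trans hm.
have : 0 <= 2^-1 ^+ m :> R by rewrite exprn_ge0.
by move: (2^-1 ^+ m) => w w0; lra.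
Qed.

(** The columns of the cokernel matrix lie in the kernel of [gram c], hence are orthogonal to [c k]
    by [gram_ker]. *)
Lemma gram_sub c k : (c k <= gram c)%MS.
Proof.
rewrite submxE; apply/eqP/rowP => j; rewrite [RHS]mxE.
rewrite -[RHS](@gram_ker c (col j (cokermx (gram c)))^T k); last first.
  by rewrite trmxK colE mulmxA mulmx_coker mul0mx.
by rewrite mxE; apply: eq_bigr => l _; rewrite !mxE.
Qed.

End Gram.

Lemma ae_countable {d} {T : measurableType d} {R : realType}
    (mu : {measure set T -> \bar R}) (I : Type) (S : set I) (P : I -> T -> Prop) :
  countable S -> (forall i, S i -> \forall x \ae mu, P i x) ->
  \forall x \ae mu, forall i, S i -> P i x.
Proof.
move=> /countable_injP[f finj] SP.
have : \forall x \ae mu, forall m i, S i -> f i = m -> P i x.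
  apply/ae_foralln => m.
  have [[i [Si fi]]|nex] := pselect (exists i, S i /\ f i = m).
    apply: filterS (SP i Si) => x Pix j Sj fj.
    by rewrite (finj j i) ?inE// fj.
  by apply: aeW => x i Si fi; exfalso; apply: nex; exists i.
by apply: filterS => x H i Si; exact: H (f i) i Si erefl.
Qed.

Lemma countable_enumeration (T : Type) (D : set T) (y0 : T) :
  D y0 -> countable D -> exists y : nat -> T, range y = D.
Proof.
move=> Dy0 /countable_injP[f finj].
have /choice[y yP] m : exists y, D y /\ ((exists z, D z /\ f z = m) -> f y = m).
  have [[z [Dz fz]]|nex] := pselect (exists z, D z /\ f z = m); first by exists z.
  by exists y0; split=> // /nex.
exists y; apply/seteqP; split=> [_ [m _ <-]|z Dz]; first by have [] := yP m.
exists (f z) => //; have [Dy yz] := yP (f z).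
by apply: finj; rewrite ?inE//; apply: yz; exists z.
Qed.

Section MeasurableSpans.
Context {d} {T : measurableType d} {R : realType} {n : nat}.

Lemma measurable_gram (c : nat -> T -> 'rV[R]_n) :
  (forall k j, measurable_fun setT (fun x => c k x ord0 j)) ->
  forall i j, measurable_fun setT (fun x => gram (c ^~ x) i j).
Proof.
move=> mc i j.
apply: (@measurable_fun_cvg _ _ _ _ (fun m x => gram_partial (c ^~ x) m i j)).
  move=> m; rewrite /gram_partial; under eq_fun do rewrite summxE.
  apply: measurable_sum => k; under eq_fun do rewrite !mxE big_ord1 !mxE.
  apply: measurable_funM; last exact: measurable_funM.
  apply: measurable_funM => //; apply: measurableT_comp => //.
  by apply: measurableT_comp => //; exact: measurable_dot.
move=> x _; apply/cvgrPdist_le => e e0.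
have e2 : 0 < e / 2 by rewrite divr_gt0.
have [N Ne] := half_expn_lt e2; exists N => // m /= /Ne.
rewrite ltr_pdivlMr// mulrC => /ltW; apply: le_trans.
exact: gram_partial_cvg.
Qed.

(** As row spaces are closed, membership means approximability by combinations of the rows with
    rational coefficients. *)
Lemma measurable_submx (c : T -> 'rV[R]_n) (A : T -> 'M[R]_n) :
  (forall j, measurable_fun setT (fun x => c x ord0 j)) ->
  (forall i j, measurable_fun setT (fun x => A x i j)) ->
  measurable [set x | (c x <= A x)%MS].
Proof.
move=> mc mA.
pose h (q : 'rV[rat]_n) x := c x - ratv q *m A x.
rewrite (_ : [set x | _] = [set x | forall m : nat, exists q : 'rV[rat]_n,
    forall j, `|h q x ord0 j| <= m.+1%:R^-1]).
  apply: measurable_forall => m; apply: measurable_exists => q.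
  apply: measurable_forall => j.
  have mh : measurable_fun setT (fun x => h q x ord0 j).
    under eq_fun do rewrite !mxE; apply: measurable_funB => //.
    by apply: measurable_sum => l; apply: measurable_funM => //.
  rewrite (_ : [set x | _] = setT `&` (fun x => h q x ord0 j) @^-1`
      `[- m.+1%:R^-1, m.+1%:R^-1]); first exact: mh.
  by apply/seteqP; split=> x /=; rewrite in_itv /= ler_norml; [|case].
apply/seteqP; split=> x /= => [/submxP[b cb] m|H].
  have m0 : 0 < m.+1%:R^-1 :> R by rewrite invr_gt0.
  pose a := n%:R * `|A x|; have a0 : 0 <= a by rewrite mulr_ge0.
  have e0 : 0 < m.+1%:R^-1 / (a + 1) by rewrite divr_gt0// ltr_pwDr.
  have [q bq] := ratv_dense b e0; exists q => j.
  rewrite /h cb -mulmxBl (le_trans (ler_entry_norm _ _ _))//.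
  rewrite (le_trans (norm_mulmx_row _ _))// mulrAC -/a.
  apply: le_trans (ler_wpM2l a0 bq) _; rewrite mulrCA ger_pMr//.
  by rewrite ler_pdivrMr ?ltr_pwDr// mul1r lerDl.
apply: submx_closed => e e0.
have [N _ Ne] := near_infty_natSinv_lt (PosNum e0).
have [q hq] := H N; exists (ratv q *m A x); split; first exact: submxMl.
apply: norm_le_entry (ltW e0) _ => i j; rewrite ord1.
by rewrite (le_trans (hq j))// ltW// (Ne _ (leqnn N)).
Qed.

End MeasurableSpans.

(** * The span in a single chart *)

Section ChartSpan.
Context {R : realType} {X : completeMetricType R}.
Variable mu : {measure set (borel X) -> \bar R}.
Hypothesis radon_mu : radon mu.
Variables (n : nat) (U : set X) (phi : X -> 'rV[R]_n).
Hypothesis chartU : is_chart mu U phi.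

Lemma compact_borel (K : set X) : compact K -> measurable (K : set (borel X)).
Proof.
move=> cK; have /open_borel/measurableC : open (~` K).
  by rewrite openC; apply: compact_closed cK; exact: metric_hausdorff.
by rewrite setCK.
Qed.

Lemma radon_compact_fin (K : set X) : compact K -> (mu K < +oo)%E.
Proof.
have [lf _] := radon_mu; move=> cK; have mK := compact_borel cK.
have /choice[V VP] x : exists V : set X, [/\ open V, V x & (mu V < +oo)%E].
  exact: lf.
move: cK; rewrite compact_cover => /(_ X setT V) [|x Kx|s _ Ks].
- by move=> x _; have [] := VP x.
- by exists x => //; have [] := VP x.
have mV (x : X) : measurable (V x : set (borel X)).
  by apply: open_borel; have [] := VP x.
have fin (l : seq X) : (mu (\big[setU/set0]_(x <- l) V x) < +oo)%E.
  elim: l => [|x l IH]; first by rewrite big_nil measure0.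
  rewrite big_cons; apply: le_lt_trans (measureU2 _ _ _) _ => //.
    exact: bigsetU_measurable.
  by apply: lte_add_pinfty => //; have [] := VP x.
apply: le_lt_trans (fin (finmap.enum_fset s)).
apply: le_measure; rewrite ?inE//; first exact: bigsetU_measurable.
by move=> x /Ks[y /= ys Vx]; rewrite -bigcup_seq; exists y.
Qed.

Lemma exists_compact (B : set (borel X)) : measurable B -> (0 < mu B)%E ->
  exists K : set X, [/\ compact K, K `<=` B & (0 < mu K)%E].
Proof.
have [_ ir] := radon_mu; move=> mB; rewrite ir// => /ereal_sup_gt[_ [K [cK KB] <-]].
by exists K.
Qed.

(** The almost everywhere properties of the chart are made to hold throughout a Borel set G. Off G
    the derivatives are replaced by 0, so that c is measurable on the whole space. *)
Lemma chart_good (f : nat -> X -> R) : (forall i, mlipschitz (f i)) ->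
  exists (G : set (borel X)) (c : nat -> borel X -> 'rV[R]_n),
  [/\ measurable G, G `<=` U, mu.-negligible (U `\` G),
    forall i j, measurable_fun setT (fun x => c i x ord0 j) &
    forall x, G x -> [/\ exists M : nat, coercive phi M.+1%:R x,
      forall i, is_partials phi (f i) x (c i x) &
      forall i, partials phi (f i) x = c i x]].
Proof.
move=> fl; have [C phiC] := chart_lipschitz chartU.
have phik x y : `|phi x - phi y| <= `|C| * mdist x y.
  by rewrite (le_trans (phiC x y))// ler_wpM2r ?mdist_ge0// ler_norm.
have : \forall x \ae mu, U x -> (exists M : nat, coercive phi M.+1%:R x) /\
    forall i, exists c, is_partials phi (f i) x c.
  have h : \forall x \ae mu, forall i, U x -> dependent_at (adjoin phi (f i)) x.
    by apply/ae_foralln => i; exact: chart_dependent chartU _ (fl i).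
  have ind := chart_independent chartU.
  have FF : Filter (almost_everywhere mu) by exact: ae_filter_ringOfSetsType.
  apply: filterS2 ind h => x xind xdep Ux; have indx := xind Ux.
  split; first exact: independent_coercive phik _ indx.
  by move=> i; apply: adjoin_partials indx (xdep i Ux).
move=> [N [mN N0 HN]]; pose G : set (borel X) := U `\` N.
have GP x : G x -> (exists M : nat, coercive phi M.+1%:R x) /\
    forall i, exists c, is_partials phi (f i) x c.
  by move=> [Ux Nx]; apply: contrapT => h; apply: Nx; apply: HN => /(_ Ux).
have mG : measurable G by apply: measurableD => //; exact: chart_measurable chartU.
pose c k (x : borel X) : 'rV[R]_n :=
  \row_j ((fun z : borel X => partials phi (f k) z ord0 j) \_ G) x.
have cE k x : G x -> partials phi (f k) x = c k x.
  by move=> Gx; apply/rowP => j; rewrite mxE patchT// inE.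
exists G, c; split=> //.
- exact: subDsetl.
- by exists N; split=> // x [Ux nUN]; apply: contrapT => Nx; exact: nUN.
- move=> k j; under eq_fun do rewrite mxE; apply/(measurable_restrictT _ mG).
  have /mlipschitzP[l fkl] := fl k.
  by apply: (measurable_partials (normr_ge0 C) phik mG fkl) => x /GP[].
- move=> x Gx; have [Mx fx] := GP x Gx; split=> // i; last exact: cE.
  by rewrite -cE//; exact: partialsP.
Qed.

(** The n rows of the Gram matrix are the sections demanded of a subbundle, whatever the dimension
    of the span. *)
Lemma chart_frame (f : nat -> X -> R) : (forall i, mlipschitz (f i)) ->
  exists s : 'I_n -> borel X -> 'rV[R]_n,
  (forall i j, measurable_fun setT (fun x => s i x ord0 j)) /\
  \forall x \ae mu, U x -> (exists M : nat, coercive phi M.+1%:R x) /\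
    (forall i, is_partials phi (f i) x (partials phi (f i) x)) /\
    forall w, w \in (\sum_i <[s i x]>)%VS <->
      lin_span (range (fun k => partials phi (f k) x)) w.
Proof.
move=> fl; have [G [c [mG _ UG mc GP]]] := chart_good fl.
exists (fun i x => row i (gram (c ^~ x))); split.
  move=> i j; under eq_fun do rewrite mxE; exact: measurable_gram.
apply: (negligibleS _ UG) => x /= /not_implyP[Ux H].
split=> // Gx; apply: H; have [Mx cx cE] := GP x Gx; split=> //; split.
  by move=> i; rewrite cE.
move=> w; have -> : (fun k => partials phi (f k) x) = c ^~ x.
  by apply/funext => k; rewrite cE.
rewrite submx_sumv; apply: iff_sym; apply: lin_span_submx (gram_sub _) _ _.
by move=> p B; exact: gram_min.
Qed.

Lemma chart_span (rho : X -> X -> R) (v : X -> R) (L Lam : R) (D : set X) :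
  0 <= L -> 0 <= Lam -> (forall y, lip_with Lam (rho^~ y)) ->
  (forall x y, rho x y <= Lam * mdist x y) ->
  (forall x y, `|v x - v y| <= L * rho x y) -> countable D -> dense D ->
  \forall x \ae mu, U x ->
    lin_span [set partials phi (rho^~ y) x | y in D] (partials phi v x).
Proof.
move=> L0 Lam0 rho_lip rho_le v_rho cD dD.
have [y0 [_ Dy0]] : (setT `&` D) !=set0.
  by apply: dD; [exists point|exact: openT].
have [y yD] := countable_enumeration Dy0 cD.
have vl : lip_with (L * Lam) v.
  split=> [|x z]; first exact: mulr_ge0.
  by rewrite (le_trans (v_rho x z))// -mulrA ler_wpM2l.
(* A single sequence gives a common good set for v and all the distance functions. *)
pose f k := if k is i.+1 then rho^~ (y i) else v.
have fl k : mlipschitz (f k).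
  apply/mlipschitzP; case: k => [|k]; first by exists (L * Lam); exact: vl.
  by exists Lam; exact: rho_lip.
have [C phiC] := chart_lipschitz chartU.
have phik x z : `|phi x - phi z| <= `|C| * mdist x z.
  by rewrite (le_trans (phiC x z))// ler_wpM2r ?mdist_ge0// ler_norm.
have [G [c [mG GU UG mc GP]]] := chart_good fl.
pose A x := gram (fun k => c k.+1 x).
pose bad := G `&` ~` [set x | (c 0%N x <= A x)%MS].
have mbad : measurable bad.
  apply: measurableI => //; apply: measurableC; apply: measurable_submx => //.
  exact: measurable_gram.
(* Splitting by M provides the uniform coercivity constant that the contradiction on a compact set
   needs. *)
pose badM (M : nat) := bad `&` rat_coercive phi M.+1%:R.
have mbadM M : measurable (badM M).
  by apply: measurableI => //; exact: measurable_rat_coercive (normr_ge0 C) phik _.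
have badM0 M : mu (badM M) = 0%E.
  apply/eqP; rewrite eq_le measure_ge0 andbT leNgt; apply/negP => B0.
  have [K [cK KB K0]] := exists_compact (mbadM M) B0.
  apply: (@differential_mem R X n phi `|C| (normr_ge0 C) phik mu K (3 * M.+1%:R)
    cK (compact_borel cK) K0 (radon_compact_fin cK) _ _ _
    rho v L Lam L0 Lam0 rho_lip rho_le v_rho A D dD).
  - by rewrite mulr_gt0.
  - by move=> x /KB[_]; apply: (rat_coercive_coercive (normr_ge0 C) phik).
  - move=> g l gl; have [|H [cH [_ _ UH _ HP]]] := @chart_good (fun=> g).
      by move=> _; apply/mlipschitzP; exists l.
    apply: (negligibleS _ UH) => x [/KB[[Gx _] _] ng].
    split; first exact: GU.
    by move=> /HP[_ /(_ 0%N) h _]; apply: ng; exists (cH 0%N x).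
  - move=> x z /KB[[Gx _] _]; rewrite -yD => -[k _ <-].
    exists (c k.+1 x); split; last exact: gram_sub (fun k => c k.+1 x) k.
    by have [_ /(_ k.+1)] := GP x Gx.
  - move=> x /KB[[Gx bx] _]; exists (c 0%N x); split; last exact/negP.
    by have [_ /(_ 0%N)] := GP x Gx.
have [N [mN N0 HN]] := UG.
have negbad : mu.-negligible bad.
  apply: (@negligibleS _ _ _ _ (\bigcup_M badM M)).
    move=> x bx; have [Gx _] := bx; have [[M Mx] _ _] := GP x Gx.
    by exists M => //; split=> //; exact: coercive_rat.
  by apply: negligible_bigcup => M; apply/negligibleP; [exact: mbadM|exact: badM0].
have := negligibleU UG negbad; apply: negligibleS => x /= /not_implyP[Ux nx].
have [Gx|nGx] := pselect (G x); last by left.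
right; split=> // cA; apply: nx.
have := (lin_span_submx (gram_sub (fun k => c k.+1 x))
  (fun p B => @gram_min _ _ (fun k => c k.+1 x) p B) (c 0%N x)).2 cA.
have [_ _ cE] := GP x Gx; rewrite -cE; apply: lin_spanS => _ [k _ <-].
rewrite -cE /=; by exists (y k) => //; rewrite -yD; exists k.
Qed.

End ChartSpan.

Section ChangeOfCharts.
Context {R : realType} {X : completeMetricType R}.

Lemma flat_sum (I : Type) (r : seq I) (h : I -> X -> R) x :
  (forall i, flat (h i) x) -> flat (fun y => \sum_(i <- r) h i y) x.
Proof.
move=> hx; elim: r => [|i r IH].
  under eq_fun do rewrite big_nil.
  by move=> e e0; exists 1 => // y _; rewrite subrr normr0 mulr_ge0 ?mdist_ge0 ?ltW.
by under eq_fun do rewrite big_cons; exact: flatD.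
Qed.

Lemma is_partials_transition m n (phi : X -> 'rV[R]_m) (psi : X -> 'rV[R]_n)
    (f : X -> R) x (c : 'rV[R]_m) (T : 'M[R]_(m, n)) :
  (forall i, is_partials psi (fun y => phi y ord0 i) x (row i T)) ->
  is_partials phi f x c -> is_partials psi f x (c *m T).
Proof.
move=> phiT /is_partialsP fc; apply/is_partialsP.
have h i : flat (fun y => c ord0 i * (phi y ord0 i - dot (row i T) (psi y))) x.
  by apply: flatZ; exact/is_partialsP.
have := flatD fc (flat_sum (index_enum 'I_m) h).
congr (flat _ x); apply/funext => y.
have -> : dot (c *m T) (psi y) = \sum_i c ord0 i * dot (row i T) (psi y).
  rewrite /dot; under eq_bigr do rewrite mxE mulr_suml.
  rewrite exchange_big /=; apply: eq_bigr => i _.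
  by rewrite mulr_sumr; apply: eq_bigr => j _; rewrite !mxE mulrA.
under eq_bigr do rewrite mulrBr.
by rewrite big_split /= sumrN /dot; ring.
Qed.

Lemma sub_vspace_lin_span (V : vectType R) (U U' : {vspace V}) (S : set V) :
  (forall w, w \in U <-> lin_span S w) -> (forall s, S s -> s \in U') ->
  (U <= U')%VS.
Proof.
by move=> US SU'; apply/subvP => w /US; exact: lin_span_subv.
Qed.

End ChangeOfCharts.

(** * Spanned subbundles and the maximum *)

Section Subbundles.
Context {R : realType} {X : completeMetricType R}.
Variables (mu : {measure set (borel X) -> \bar R}) (A : @chart_family R X).
Hypotheses (atlasA : is_atlas mu A) (compA : compatible A).

(** The fibres in two charts are spanned by the differentials of the same functions, and the
    transition matrix carries one coordinate row to the other by the chain rule and uniqueness; this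
    gives the glueing. The member [f0] lets a sequence enumerate Phi. *)
Lemma exists_spanned (Phi : set (X -> R)) (f0 : X -> R) : Phi f0 ->
  countable Phi -> (forall f, Phi f -> mlipschitz f) ->
  exists W : subbundle mu A, spanned_by W Phi.
Proof.
move=> Phi0 cPhi lPhi; have [f fPhi] := countable_enumeration Phi0 cPhi.
have fl k : mlipschitz (f k) by apply: lPhi; rewrite -fPhi; exists k.
have [charts _] := atlasA.
pose s a := projT1 (cid (chart_frame (charts a) fl)).
have sP a := projT2 (cid (chart_frame (charts a) fl)).
pose fib a x := (\sum_i <[s a i x]>)%VS.
have ae_charts : \forall x \ae mu, forall a, setT a -> chart_dom a x ->
    (exists M : nat, coercive (@chart_map _ _ A a) M.+1%:R x) /\
    (forall i, is_partials (@chart_map _ _ A a) (f i) x (differential (f i) a x)) /\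
    forall w, w \in fib a x <->
      lin_span (range (fun k => differential (f k) a x)) w.
  by apply: ae_countable => // a _; have [_] := sP a.
have FF : Filter (almost_everywhere mu) by exact: ae_filter_ringOfSetsType.
have fib_measurable (a : chart_idx A) :
    exists t : 'I_(chart_dim a) -> X -> 'rV[R]_(chart_dim a),
      (forall i j, measurable_fun (chart_dom a : set (borel X))
         (fun x : borel X => t i x ord0 j)) /\
      (forall x, chart_dom a x -> fib a x = (\sum_i <[t i x]>)%VS).
  exists (s a); split=> // i j; have [ms _] := sP a.
  exact: measurable_funS (ms i j).
have fib_glue : \forall x \ae mu, forall a b : chart_idx A,
    chart_dom a x -> chart_dom b x ->
    fib b x = (linfun (mulmxr (transition a b x)) @: fib a x)%VS.
  apply: filterS ae_charts => x H a b Ua Ub.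
  have [_ [fa spa]] := H a Logic.I Ua; have [[M Mb] [fb spb]] := H b Logic.I Ub.
  set T := transition a b x.
  have dT k : differential (f k) b x = differential (f k) a x *m T.
    apply: (is_partials_uniq Mb (ler0n _ _) (fb k)).
    apply: is_partials_transition (fa k) => i; rewrite rowK.
    by apply: partialsP; exact: compA.
  apply/eqP; rewrite eqEsubv; apply/andP; split.
    apply: sub_vspace_lin_span spb _ => _ [k _ <-].
    rewrite dT -[_ *m T](lfunE (mulmxr T)) memv_img//.
    by apply/spa; apply: sub_lin_span; exists k.
  have : (fib a x <= linfun (mulmxr T) @^-1: fib b x)%VS.
    apply: sub_vspace_lin_span spa _ => _ [k _ <-].
    rewrite -memv_preim lfunE /= -dT.
    by apply/spb; apply: sub_lin_span; exists k.
  move=> /subvP sub; apply/subvP => _ /memv_imgP[u ua ->].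
  by rewrite memv_preim; exact: sub.
exists (Subbundle fib_measurable fib_glue).
apply: filterS ae_charts => x H a Ua /=; have [_ [_ sp]] := H a Logic.I Ua.
have -> : [set differential g a x | g in Phi] =
    range (fun k => differential (f k) a x).
  rewrite -fPhi; apply/seteqP; split=> [_ [_ [k _ <-] <-]|_ [k _ <-]].
    by exists k.
  by exists (f k) => //; exists k.
by apply/seteqP; split=> w /sp.
Qed.

End Subbundles.

Theorem theorem1p18 (R : realType) (X : completeMetricType R)
    (mu : {measure set (borel X) -> \bar R}) (A : @chart_family R X)
    (Z : metricType R) (F : X -> Z)
    (sepX : separable_space X) (radon_mu : radon mu)
    (diffX : differentiability_space mu)
    (atlasA : is_atlas mu A) (compA : compatible A)
    (lipF : lipschitz_map F) :
  let rho := pullback_dist F in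
  exists W : subbundle mu A,
    [/\ is_maximum rho W,
        (forall W' : subbundle mu A, is_maximum rho W' -> subbundle_eq W' W),
        (forall v : X -> R, rho_lipschitz rho v -> in_subbundle W v) &
        (forall D : set X, countable D -> dense D ->
           spanned_by W [set (fun x => rho x y) | y in D])].
Proof.
move=> rho; have [C FC] := lipF; have [charts _] := atlasA.
have FF : Filter (almost_everywhere mu) by exact: ae_filter_ringOfSetsType.
have rho_le x y : rho x y <= `|C| * mdist x y.
  by rewrite (le_trans (FC x y))// ler_wpM2r ?mdist_ge0// ler_norm.
have rho_rho y : rho_lipschitz rho (rho^~ y).
  exists 1 => x z; have [_ /(_ (F x) (F z))] := lip_mdist (F y).
  exact.
have rho_lip y : lip_with `|C| (rho^~ y).
  split=> // x z; have [_ /(_ (F x) (F z))] := lip_mdist (F y).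
  by rewrite mul1r => /le_trans; apply; exact: rho_le.
have rho_mlip v : rho_lipschitz rho v -> mlipschitz v.
  move=> [l vl]; exists (`|l| * `|C|) => x y; rewrite -mulrA.
  apply: le_trans (vl x y) _; apply: (@le_trans _ _ (`|l| * rho x y)).
    by rewrite ler_wpM2r ?mdist_ge0// ler_norm.
  by rewrite ler_wpM2l.
have span_rho v D : rho_lipschitz rho v -> countable D -> dense D ->
    \forall x \ae mu, forall a : chart_idx A, chart_dom a x ->
    lin_span [set differential f a x | f in [set rho^~ y | y in D]]
      (differential v a x).
  move=> [l vl] cD dD.
  have vl' x y : `|v x - v y| <= `|l| * rho x y.
    by rewrite (le_trans (vl x y))// ler_wpM2r ?mdist_ge0// ler_norm.
  have : \forall x \ae mu, forall a : chart_idx A, setT a -> chart_dom a x ->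
      lin_span [set differential (rho^~ y) a x | y in D] (differential v a x).
    apply: ae_countable => // a _.
    exact: (chart_span radon_mu (charts a) (normr_ge0 l) (normr_ge0 C) rho_lip
      rho_le vl' cD dD).
  apply: filterS => x H a Ua; have := H a Logic.I Ua; apply: lin_spanS.
  by move=> _ [y Dy <-]; exists (rho^~ y) => //; exists y.
have [D0 cD0 dD0] := sepX.
have [y0 [_ Dy0]] : (setT `&` D0) !=set0.
  by apply: dD0; [exists point|exact: openT].
pose Phi D := [set rho^~ y | y in D].
have cPhi D : countable D -> countable (Phi D).
  by apply: sub_countable; exact: card_image_le.
have Phi_rho D f : Phi D f -> rho_lipschitz rho f by move=> [y _ <-].
have [W WP] : exists W : subbundle mu A, spanned_by W (Phi D0).
  apply: (@exists_spanned _ _ _ _ atlasA compA (Phi D0) (rho^~ y0)).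
  - by exists y0.
  - exact: cPhi.
  - by move=> f /Phi_rho; exact: rho_mlip.
have WP' : \forall x \ae mu, forall a : chart_idx A, chart_dom a x ->
    [set` fibre W a x] = lin_span [set differential f a x | f in Phi D0].
  exact: WP.
have W_mem v : rho_lipschitz rho v ->
    \forall x \ae mu, forall a : chart_idx A, chart_dom a x ->
    differential v a x \in fibre W a x.
  move=> vl; have Hv := span_rho v D0 vl cD0 dD0.
  apply: filterS2 WP' Hv => x WPx H a Ua.
  by have := H a Ua; rewrite -(WPx a Ua).
have W_sub (W' : subbundle mu A) : SubBundles rho W' -> subbundle_le W' W.
  move=> [Phi' [cPhi' Phi'_rho W'P]].
  have W'W := ae_countable cPhi' (fun f Pf => W_mem f (Phi'_rho f Pf)).
  have {}W'P : \forall x \ae mu, forall a : chart_idx A, chart_dom a x ->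
      [set` fibre W' a x] = lin_span [set differential f a x | f in Phi'].
    exact: W'P.
  apply: filterS2 W'P W'W => x W'Px H a Ua; apply/subvP => w.
  move=> w'; have {w'} : [set` fibre W' a x] w by [].
  rewrite (W'Px a Ua); apply: lin_span_subv => _ [f Pf <-].
  exact: H f Pf a Ua.
have W_in : SubBundles rho W.
  by exists (Phi D0); split; [exact: cPhi|exact: Phi_rho|].
exists W; split=> //.
- move=> W' [W'_in W'_max].
  have le1 : \forall x \ae mu, forall a : chart_idx A, chart_dom a x ->
      (fibre W' a x <= fibre W a x)%VS by exact: W_sub.
  have le2 : \forall x \ae mu, forall a : chart_idx A, chart_dom a x ->
      (fibre W a x <= fibre W' a x)%VS by exact: W'_max.
  apply: filterS2 le1 le2 => x H H' a Ua.
  by apply/eqP; rewrite eqEsubv (H a Ua) (H' a Ua).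
- move=> D cD dD.
  have h1 := ae_countable (cPhi D cD) (fun f Pf => W_mem f (Phi_rho D f Pf)).
  (* The functions generating W are themselves rho-Lipschitz, so [span_rho] puts their differentials
     in the span over the other dense set D. *)
  have h2 := ae_countable (cPhi D0 cD0)
    (fun f Pf => span_rho f D (Phi_rho D0 f Pf) cD dD).
  apply: filterS3 WP' h1 h2 => x WPx H1 H2 a Ua.
  apply/seteqP; split=> [w|w].
    rewrite (WPx a Ua); apply: lin_span_trans => _ [f Pf <-].
    exact: H2 f Pf a Ua.
  apply: lin_span_subv => _ [f Pf <-]; exact: H1 f Pf a Ua.
Qed.
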